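(* Let $k$ be a field, $R=k[x_1,\dots,x_d]$ a standard graded polynomial ring, and $I=(\alpha_1,\dots,\alpha_m)\subset R$ a perfect ideal of height $2$ with $m>d$ such that, with respect to $\alpha_1,\dots,\alpha_m$, $I$ has a Hilbert–Burch matrix $\varphi=[v_1|\cdots|v_{m-1}]$ with $v_i\in(R_1)^m$ for $1\le i\le m-2$ and $v_{m-1}\in(R_n)^m$ for some $n\ge1$ (so $n$ is the degree of the entries of the last column). Assume $I$ satisfies $G_d$. Then $\mathcal A=\mathcal L:(x_1,\dots,x_d)^n$.
   Context: $G_d$: $\mu(I_P)\le\operatorname{ht}P$ for all primes $P\supseteq I$ with $\operatorname{ht}P<d$. $S=R[T_1,\dots,T_m]$; $\mathcal A$ is the kernel of the $R$-algebra map $S\to\mathcal R(I)=R[It]$, $T_j\mapsto\alpha_jt$ (the defining ideal of the Rees algebra). Writing $[T_1\cdots T_m]\cdot\varphi=[L_1\cdots L_{m-2}\ g]$, $\mathcal L=(L_1,\dots,L_{m-2},g)\subset S$. *)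

(* Defs.v *)
From HB Require Import structures.
From mathcomp Require Import all_boot all_order all_algebra.
From mathcomp Require Import mpoly.

Set Implicit Arguments.
Unset Strict Implicit.
Unset Printing Implicit Defensive.

Import GRing.Theory.
Local Open Scope ring_scope.

Section CommAlg.
Variable R : comNzRingType.

Definition subI (I J : R -> Prop) : Prop := forall x, I x -> J x.

Definition is_ideal (I : R -> Prop) : Prop :=
  [/\ I 0, (forall a b, I a -> I b -> I (a + b)) & (forall r a, I a -> I (r * a))].

Definition ideal_of (A : R -> Prop) : R -> Prop :=
  fun f => exists (N : nat) (g c : 'I_N -> R),
    (forall i, A (g i)) /\ f = \sum_(i < N) c i * g i.

Definition ideal_seq (s : seq R) : R -> Prop := ideal_of (fun x => x \in s).

Definition prime_ideal (P : R -> Prop) : Prop :=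
  [/\ is_ideal P, ~ P 1 & (forall a b, P (a * b) -> P a \/ P b)].

Definition prime_chain (c : nat -> R -> Prop) (h : nat) : Prop :=
  (forall i, (i <= h)%N -> prime_ideal (c i)) /\
  (forall i, (i < h)%N -> subI (c i) (c i.+1) /\ exists x, c i.+1 x /\ ~ c i x).

Definition height_ge (P : R -> Prop) (h : nat) : Prop :=
  exists c, prime_chain c h /\ forall x, c h x <-> P x.

Definition height_eq (P : R -> Prop) (h : nat) : Prop :=
  height_ge P h /\ ~ height_ge P h.+1.

Definition ideal_height_eq (I : R -> Prop) (h : nat) : Prop :=
  (exists P, [/\ prime_ideal P, subI I P & height_eq P h]) /\
  (forall P, prime_ideal P -> subI I P -> height_ge P h).

Definition regular_seq_in (I : R -> Prop) (a : seq R) : Prop :=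
  [/\ (forall x, x \in a -> I x),
      (forall j r, (j < size a)%N ->
          ideal_seq (take j a) (a`_j * r) -> ideal_seq (take j a) r)
    & ~ ideal_seq a 1].

Definition grade_eq (I : R -> Prop) (g : nat) : Prop :=
  (exists a, size a = g /\ regular_seq_in I a) /\
  (forall a, regular_seq_in I a -> (size a <= g)%N).

(* A finite free resolution of R/I of length <= p:
     0 -> ... -> F_2 --f 0--> F_1 --gen--> F_0 = R -> R/I -> 0,
   with F_{i+1} = R^(b i), F_j = 0 for j > p, the map F_{i+2} -> F_{i+1}
   given by the matrix f i (acting on column vectors), and F_1 -> R by the
   row vector gen, whose image is I. *)
Definition free_res_quot (I : R -> Prop) (p : nat) : Prop :=
  exists (b : nat -> nat) (gen : 'rV[R]_(b 0%N)) (f : forall i, 'M[R]_(b i, b i.+1)),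
  [/\ (forall i, (p <= i)%N -> b i = 0%N),
      (forall x, I x <-> exists v : 'cV[R]_(b 0%N), x = (gen *m v) 0 0),
      (forall v : 'cV[R]_(b 0%N), gen *m v = 0 <-> exists w, v = f 0%N *m w)
    & (forall i (v : 'cV[R]_(b i.+1)), f i *m v = 0 <-> exists w, v = f i.+1 *m w)].

Definition pd_quot_eq (I : R -> Prop) (p : nat) : Prop :=
  free_res_quot I p /\ forall q, free_res_quot I q -> (p <= q)%N.

Definition perfect (I : R -> Prop) : Prop :=
  exists g, grade_eq I g /\ pd_quot_eq I g.

(* mu(I_P) <= s : I R_P is generated by (the images of) s elements of I.
   For a in I, a/1 lies in (g_1,...,g_s)R_P iff u*a in (g_1,...,g_s) for
   some u not in P. *)
Definition mu_loc_le (I P : R -> Prop) (s : nat) : Prop :=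
  exists g : 'I_s -> R, (forall i, I (g i)) /\
    forall a, I a -> exists u, ~ P u /\ ideal_of (fun x => exists i, x = g i) (u * a).

Definition G_cond (I : R -> Prop) (d : nat) : Prop :=
  forall P, prime_ideal P -> subI I P ->
    forall h, height_eq P h -> (h < d)%N -> mu_loc_le I P h.

Definition ideal_mul (I J : R -> Prop) : R -> Prop :=
  ideal_of (fun x => exists a b, [/\ I a, J b & x = a * b]).

Fixpoint ideal_pow (I : R -> Prop) (n : nat) : R -> Prop :=
  match n with
  | 0%N => fun _ => True
  | n'.+1 => ideal_mul (ideal_pow I n') I
  end.

Definition colon (L J : R -> Prop) : R -> Prop :=
  fun x => forall y, J y -> L (x * y).

End CommAlg.

Section Rees.
Variables (k : fieldType) (d m : nat).

Notation Rk := {mpoly k[d]}.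
Notation Sk := {mpoly Rk[m]}.

Definition ideal_row (alpha : 'rV[Rk]_m) : Rk -> Prop :=
  ideal_of (fun x => exists i, x = alpha 0 i).

Definition hilbert_burch (alpha : 'rV[Rk]_m) (phi : 'M[Rk]_(m, m.-1)) : Prop :=
  [/\ alpha *m phi = 0,
      (forall v : 'cV[Rk]_m, alpha *m v = 0 -> exists w, v = phi *m w)
    & (forall w : 'cV[Rk]_(m.-1), phi *m w = 0 -> w = 0)].

Definition rees_ideal (alpha : 'rV[Rk]_m) : Sk -> Prop :=
  fun F => mmap (fun c : Rk => c%:P) (fun j => (alpha 0 j)%:P * 'X) F = 0.

Definition L_ideal (phi : 'M[Rk]_(m, m.-1)) : Sk -> Prop :=
  ideal_of (fun F => exists j : 'I_(m.-1),
    F = \sum_(i < m) 'X_i * (phi i j)%:MP).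

Definition xS : Sk -> Prop :=
  ideal_of (fun F => exists i : 'I_d, F = ('X_i : Rk)%:MP).

End Rees.

(* Main.v *)
(* Let L_1, ..., L_{m-2}, g be the equations of the symmetric algebra S/L, and K their
   Koszul complex over S = R[T_1, ..., T_m].  By G_d, at every prime Q of R strictly
   below (x_1, ..., x_d) the ideal I is generated by at most ht Q of the alpha's, so L
   contains locally at least m - ht Q forms that are monic and linear in distinct T_j;
   with ht Q elements of Q, each monic up to a unit in its own variable x_i, they make a
   regular sequence as long as K, and by induction on Q the homology of K, as well as
   A/L, is killed by powers of this sequence.  A complex of length at most the length of
   such a sequence is acyclic, so K is exact and A = L at Q.

   Hence at the origin the positive homology of K and A/L are (x)-torsion.  The same
   acyclicity argument, now with the sequence x_1, ..., x_d and keeping track of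
   x-degrees, shows that A/L vanishes in the degrees e with K_d/(x)K_d zero in degrees
   >= e + d; since the generators of K_d have degree at most d - 1 + n, these are the
   e >= n.  So (x)^n A is contained in L, and the converse inclusion holds because A is
   a prime ideal meeting R in 0.

   Localization at a prime is never formed: statements hold up to a factor [u] taken in
   a multiplicative set [U]. *)

Require Import Defs.
From HB Require Import structures.
From mathcomp Require Import all_boot all_order all_algebra.
From mathcomp Require Import mpoly.
From mathcomp Require Import zify ring.
From mathcomp Require boolp classical_sets.
Import GRing.Theory.
Local Open Scope ring_scope.

Set Implicit Arguments.
Unset Strict Implicit.
Unset Printing Implicit Defensive.

(** * Primes avoiding a multiplicative set *)

(** [A / L] is handled as homology in degree 0: there the cycles are by decree the elements of [A]
    instead of all scalars. The acyclicity argument survives this change because nonzero elements of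
    R can be cancelled modulo [A]; this is why the first term of the sequence has to come from R.
    Vanishing in degree 0 asks for a sequence longer than the complex, while in positive degrees one
    as long as the complex suffices. With m - 1 equations the count is just enough: a prime Q
    containing I, of dimension D, has height at most d - D; it contains d - D triangular elements
    and leaves at least m - (d - D) of the T_j as pivots, in all at least m terms. At the origin
    only the d terms x_1, ..., x_d are used, and the missing vanishing in top degree comes from the
    grading, since elements of positive x-degree lie in (x)S. Regularity is never deduced from
    depth: pseudo-division proves it for sequences whose terms have, each in a variable absent from
    the preceding ones, a leading coefficient in [U]. *)

Definition mul_closed (R : comNzRingType) (U : R -> Prop) : Prop :=
  U 1 /\ forall a b, U a -> U b -> U (a * b).

(** An ideal M maximal among those containing J and missing U is prime: for a and b outside M, both
    M + (a) and M + (b) meet U, and the product of two such elements lies in U and in M + (ab). *)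
Lemma exists_prime_disjoint (R : comNzRingType) (J U : R -> Prop) :
  is_ideal J -> mul_closed U -> (forall x, J x -> ~ U x) ->
  exists P, [/\ prime_ideal P, subI J P & forall x, P x -> ~ U x].
Proof.
move=> [J0 JD JM] [U1 UM] JU.
pose good (A : R -> Prop) := is_ideal A /\ forall x, A x -> ~ U x.
(* The union with J is built into the predicate, so that the empty chain, whose union is empty, is
   no exception. *)
have [F FP Ftot|A [[Aid AU] Amax]] :=
    @classical_sets.Zorn_bigcup R (fun A => good (fun x => A x \/ J x)).
  split; last first.
    by move=> x [[A FA Ax]|Jx]; [apply: (FP A FA).2; left|exact: JU].
  split=> [|a b|r a]; first by right.
  - have sum A : F A -> A a \/ J a -> A b \/ J b ->
        classical_sets.bigcup F id (a + b) \/ J (a + b).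
      move=> FA Aa Ab; have [[_ AD _] _] := FP A FA.
      by have [Aab|Jab] := AD a b Aa Ab; [left; exists A|right].
    move=> [[A FA Aa]|Ja] [[B FB Bb]|Jb]; last by right; exact: JD.
    + have [AB|BA] := Ftot A B FA FB.
      * by apply: (sum B) => //; left=> //; exact: AB.
      * by apply: (sum A) => //; left=> //; exact: BA.
    + by apply: (sum A) => //; [left|right].
    + by apply: (sum B) => //; [right|left].
  - move=> [[A FA Aa]|Ja]; last by right; exact: JM.
    have [[_ _ AM] _] := FP A FA.
    by have [Ara|Jra] := AM r a (or_introl Aa); [left; exists A|right].
pose M x := A x \/ J x.
have [M0 MD MM] : is_ideal M by [].
exists M; split=> //; last by move=> x; right.
have key a : ~ M a -> exists u m r, [/\ U u, M m & u = m + r * a].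
  move=> nMa; apply: boolp.contrapT => nex.
  pose B x := exists m r, M m /\ x = m + r * a.
  apply: (Amax B).
    split; first by move=> x Ax; exists x, 0; rewrite mul0r addr0; split=> //; left.
    move=> BA; apply: nMa; left; apply: BA; exists 0, 1.
    by rewrite add0r mul1r; split.
  have BE x : (B x \/ J x) -> B x.
    by case=> // Jx; exists x, 0; rewrite mul0r addr0; split=> //; right.
  split; last by move=> x /BE[m [r [Mm ->]]] Ux; apply: nex; exists (m + r * a), m, r.
  split; first by right.
  - move=> x y /BE[m [r [Mm ->]]] /BE[m' [r' [Mm' ->]]]; left.
    by exists (m + m'), (r + r'); split; [exact: MD|rewrite mulrDl addrACA].
  - move=> s x /BE[m [r [Mm ->]]]; left.
    by exists (s * m), (s * r); split; [exact: MM|rewrite mulrDr mulrA].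
split=> [//||a b Mab]; first by move=> M1; exact: AU 1 M1 U1.
apply: boolp.contrapT => /boolp.not_orP[/key[u [m [r [Uu Mm uE]]]]
  /key[v [n [s [Uv Mn vE]]]]].
apply: (AU (u * v)) (UM _ _ Uu Uv).
rewrite uE vE mulrDl mulrDr; apply: (MD); [apply: (MD)|].
- by rewrite mulrC; apply: MM.
- by rewrite mulrC; apply: MM.
- by rewrite mulrDr; apply: MD; [exact: MM|rewrite mulrACA; exact: MM].
Qed.

(** * An acyclicity lemma *)

Section Acyclicity.
Variables (S : comNzRingType) (V : lmodType S) (dl : {linear V -> V}).
Variables (U : S -> Prop) (D : nat -> int -> V -> Prop) (N : nat -> V -> Prop).
Variables (c q : nat) (e0 : int) (f : nat -> S) (Z0 : V -> Prop).

Hypothesis U_mul : mul_closed U.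
Hypothesis D0 : forall p e, D p e 0.
Hypothesis DB : forall p e x y, D p e x -> D p e y -> D p e (x - y).
Hypothesis DU : forall p e u x, U u -> D p e x -> D p e (u *: x).
Hypothesis Df : forall i p e x, (i < c)%N -> D p e x -> D p (e + 1) (f i *: x).
Hypothesis Ddl : forall p e x, D p.+1 e x -> D p e (dl x).
Hypothesis dldl : forall x, dl (dl x) = 0.
Hypothesis N0 : forall i, N i 0.
Hypothesis NB : forall i x y, N i x -> N i y -> N i (x - y).
Hypothesis NZ : forall i s x, N i x -> N i (s *: x).
Hypothesis NS : forall i x, N i x -> N i.+1 x.
Hypothesis Nf : forall i x, N i.+1 (f i *: x).
Hypothesis Ndl : forall i x, N i x -> N i (dl x).
Hypothesis N_regular : forall i p e x,
  (i < c)%N -> D p e x -> N i (f i *: x) -> N i x.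
Hypothesis N_decomp : forall i p e x, (i < c)%N -> D p (e + 1) x -> N i.+1 x ->
  exists u v, [/\ U u, D p e v & N i (u *: x - f i *: v)].
Hypothesis top : forall e x, (e0 + c%:Z <= e)%R -> D (q + c) e x -> N c x.
Hypothesis Z0P : forall e w z, D 0 e w -> D 1 (e + 1) z ->
  N 0 (dl z - f 0%N *: w) -> Z0 w.

(* [N i] plays the role of the submodule [(f 0, ..., f (i-1))V], saturated by [U], so that
   what follows concerns the complex reduced modulo the first [i] terms of the sequence.
   [Z0] replaces the cycles in homological degree [0], where every element is one. *)
Definition relative_cycle i p x := if p is 0 then Z0 x else N i (dl x).

(** Reduction modulo one more term relates a class to one that is lower by one both in homological
    and in internal degree; hence the bounds [q + i] and [e0 + i]. The exponent [a] may depend on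
    the class and on [j]. *)
Definition torsion_homology i := forall p e x, (q + i <= p)%N -> (e0 + i%:Z <= e)%R ->
  D p e x -> relative_cycle i p x -> forall j, (j < c)%N ->
  exists (a : nat) u v, [/\ U u, D p.+1 (e + a%:Z) v & N i ((u * f j ^+ a) *: x - dl v)].

Definition vanishing_homology i := forall e x, (e0 + i%:Z <= e)%R ->
  D (q + i) e x -> relative_cycle i (q + i) x ->
  exists u v, [/\ U u, D (q + i).+1 e v & N i (u *: x - dl v)].


Let ND i x y : N i x -> N i y -> N i (x + y).
Proof. by move=> Nx Ny; rewrite -[y]opprK; apply: NB => //; rewrite -sub0r; apply: NB. Qed.

Let dlB x y : dl (x - y) = dl x - dl y. Proof. exact: linearB. Qed.

Let PoszS (b : nat) : b.+1%:Z = b%:Z + 1 :> int. Proof. by lia. Qed.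

Let dlZ a x : dl (a *: x) = a *: dl x. Proof. exact: linearZ. Qed.

(* A cycle [x] modulo [f i] has [dl x = f i w] with [w] a cycle; if [f j ^+ a] kills the
   class of [w], then [f j ^+ a x] is a cycle up to a multiple of [f i]. *)
Lemma torsion_homology_succ i : (i < c)%N -> torsion_homology i -> torsion_homology i.+1.
Proof.
move=> lt_ic tors [|p] e x; first by rewrite addnS.
rewrite addnS ltnS => le_p le_e Dx Nx j lt_jc.
have [e' eE] : exists e', e = e' + 1 by exists (e - 1); rewrite subrK.
rewrite {e}eE in Dx le_e *.
have le_e' : (e0 + i%:Z <= e')%R by lia.
have [u1 [w [Uu1 Dw Nw]]] := N_decomp lt_ic (Ddl Dx) Nx.
(* For p = 0 the bound [q + i <= p] leaves only q = i = 0, the case covered by [Z0P]. For p > 0,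
   applying [dl] once more shows that f i kills [dl w] modulo [N i], and regularity applies. *)
have cyc_w : relative_cycle i p w.
  case: p le_p Dx Dw {Nx} => [|p] le_p Dx Dw.
    have [q0 i0] : q = 0%N /\ i = 0%N by lia.
    rewrite i0 /= in Nw *; apply: (Z0P (z := u1 *: x)) Dw _ _; first exact: DU.
    by rewrite dlZ.
  have := Ndl Nw; rewrite dlB !dlZ dldl scaler0 sub0r => /(NZ (-1)).
  rewrite scaleN1r opprK; exact: N_regular lt_ic (Ddl Dw).
have [a [u2 [v [Uu2 Dv Nv]]]] := tors p e' w le_p le_e' Dw cyc_w j lt_jc.
pose y := (u2 * u1 * f j ^+ a) *: x - f i *: v.
have Dpow b e1 z : D p.+1 e1 z -> D p.+1 (e1 + b%:Z) (f j ^+ b *: z).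
  move=> Dz; elim: b => [|b IH]; first by rewrite expr0 scale1r addr0.
  by rewrite exprS -scalerA PoszS addrA; apply: Df.
have Dy : D p.+1 (e' + 1 + a%:Z) y.
  apply: DB; last by rewrite addrAC; apply: Df.
  by rewrite -scalerA; apply: DU; [exact: U_mul.2|exact: Dpow].
have cyc_y : N i (dl y).
  rewrite /y dlB !dlZ.
  have := ND (NZ (u2 * f j ^+ a) Nw) (NZ (f i) Nv).
  rewrite !scalerBr !scalerA; congr (N i _).
  by rewrite [u2 * u1 * _]mulrAC [f i * _]mulrC addrA subrK.
have le2 : (q + i <= p.+1)%N by lia.
have le3 : (e0 + i%:Z <= e' + 1 + a%:Z)%R by lia.
have [b [u3 [t [Uu3 Dt Nt]]]] := tors p.+1 _ y le2 le3 Dy cyc_y j lt_jc.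
exists (a + b)%N, (u3 * u2 * u1), t; split.
- by do 2?apply: U_mul.2.
- by rewrite PoszD addrA.
have := ND (NS Nt) (NZ (u3 * f j ^+ b) (Nf i v)).
congr (N _ _); rewrite /y scalerBr addrAC subrK scalerA; congr (_ *: _ - _).
by rewrite exprD; ring.
Qed.

(* Vanishing modulo [f i] one homological degree higher makes multiplication by [f i]
   injective on homology, hence on a torsion module. *)
Lemma vanishing_homology_pred i :
  (i < c)%N -> vanishing_homology i.+1 -> torsion_homology i -> vanishing_homology i.
Proof.
move=> lt_ic van tors e x le_e Dx cyc.
have cancel_f e1 u y v : (e0 + i%:Z <= e1)%R -> U u -> D (q + i) e1 y ->
    D (q + i).+1 (e1 + 1) v -> N i ((u * f i) *: y - dl v) ->
    exists u v, [/\ U u, D (q + i).+1 e1 v & N i (u *: y - dl v)].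
  move=> le_e1 Uu Dy Dv Nyv.
  have N1dlv : N i.+1 (dl v).
    have := NB (NZ u (Nf i y)) (NS Nyv).
    by rewrite opprB addrC scalerA subrK.
  have le_e2 : (e0 + i.+1%:Z <= e1 + 1)%R by lia.
  have := van (e1 + 1) v le_e2.
  rewrite addnS => /(_ Dv N1dlv)[u' [w [Uu' Dw Nw]]].
  have Duvw : D (q + i).+1 (e1 + 1) (u' *: v - dl w).
    by apply: DB; [exact: DU|exact: Ddl].
  have [u2 [t [Uu2 Dt Nt]]] := N_decomp lt_ic Duvw Nw.
  exists (u2 * u' * u), t; split=> //; first by do 2?apply: U_mul.2.
  apply: (N_regular (p := q + i) (e := e1)) => //.
    by apply: DB; [apply: DU => //; do 2?apply: U_mul.2|exact: Ddl].
  have := ND (NZ (u2 * u') Nyv) (Ndl Nt).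
  rewrite dlB !dlZ dlB dlZ dldl subr0.
  rewrite !scalerBr !scalerA addrA subrK => H.
  by rewrite [f i * _]mulrC -[X in X *: _]mulrA.
have [a [u [v [Uu Dv Nv]]]] := tors (q + i)%N e x (leqnn _) le_e Dx cyc i lt_ic.
(* The exponent is brought down to 0 by cancelling one factor f i at a time: [cancel_f] is applied
   to [f i ^+ a *: x]. *)
elim: a u v Uu Dv Nv => [|a IH] u v Uu Dv Nv.
  by exists u, v; split=> //; rewrite ?addr0 // in Dv; rewrite expr0 mulr1 in Nv.
have Dfx : D (q + i) (e + a%:Z) (f i ^+ a *: x).
  elim: a {IH Dv Nv} => [|a IHa]; first by rewrite addr0 expr0 scale1r.
  by rewrite exprS -scalerA PoszS addrA; apply: Df.
have [|||u' [v' [Uu' Dv' Nv']]] := cancel_f (e + a%:Z) u (f i ^+ a *: x) v _ Uu Dfx.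
- by lia.
- by rewrite -addrA -PoszS.
- by rewrite scalerA -mulrA -exprS.
by apply: (IH u' v') => //; rewrite -scalerA.
Qed.

(** Torsion is carried upwards from i = 0 to i = c, then vanishing is carried back down. The descent
    starts at i = c, where by [top] every element of the relevant degree already lies in [N c], so 0
    bounds it. *)
Theorem homology_vanishes : torsion_homology 0 -> vanishing_homology 0.
Proof.
move=> tors0.
have tors i : (i <= c)%N -> torsion_homology i.
  by elim: i => // i IH lt_ic; apply: torsion_homology_succ => //; exact: IH (ltnW _).
have van j : (j <= c)%N -> vanishing_homology (c - j).
  elim: j => [|j IH] le_j.
    rewrite subn0 => e x le_e Dx _; exists 1, 0; split=> //; first exact: U_mul.1.
    by rewrite scale1r linear0 subr0; exact: top le_e Dx.
  have lt_c : (c - j.+1 < c)%N by lia.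
  apply: vanishing_homology_pred => //; last by apply: tors; lia.
  by rewrite subnSK //; apply: IH; exact: ltnW.
by have := van c (leqnn c); rewrite subnn.
Qed.

End Acyclicity.

(** * Koszul complexes as iterated mapping cones *)

Section KoszulComplex.
Variable S : comNzRingType.

(** The exterior algebra on r generators with all homological degrees together: (a, b) stands for a
    plus b times the last generator. The degrees are recovered by [koszul_piece]. *)
Fixpoint koszul r : lmodType S :=
  if r is r'.+1 then (koszul r' * koszul r')%type : lmodType S else (S^o : lmodType S).

Variable l : nat -> S.

Fixpoint koszul_d r : koszul r -> koszul r :=
  if r is r'.+1 return koszul r -> koszul r
  then fun z => (koszul_d z.1 + l r' *: z.2, - koszul_d z.2)
  else fun _ => 0.

Lemma koszul_d_is_linear r : linear (@koszul_d r).
Proof.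
elim: r => [|r IH] a x y /=; first by rewrite scaler0 addr0.
rewrite !IH; apply: injective_projections => /=.
  rewrite !scalerDr addrACA; congr (_ + (_ + _)).
  by rewrite !scalerA mulrC.
by rewrite opprD -scalerN.
Qed.

HB.instance Definition _ r :=
  GRing.isLinear.Build S (koszul r) (koszul r) _ (@koszul_d r) (@koszul_d_is_linear r).

Lemma koszul_dd r (z : koszul r) : koszul_d (koszul_d z) = 0.
Proof.
elim: r z => [|r IH] //= z; apply: injective_projections => /=.
  by rewrite linearD linearZ /= IH add0r scalerN subrr.
by rewrite linearN /= IH !oppr0.
Qed.

(** Exterior multiplication by the j-th generator, up to sign. *)
Fixpoint koszul_h j r : koszul r -> koszul r :=
  if r is r'.+1 return koszul r -> koszul r
  then fun z => if j == r' then (0, z.1) else (koszul_h j z.1, - koszul_h j z.2)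
  else fun _ => 0.

Lemma koszul_h_is_linear j r : linear (@koszul_h j r).
Proof.
elim: r => [|r IH] a x y /=; first by rewrite scaler0 addr0.
case: eqP => _; apply: injective_projections; rewrite /= ?scaler0 ?addr0 ?IH //.
by rewrite opprD -scalerN.
Qed.

HB.instance Definition _ j r :=
  GRing.isLinear.Build S (koszul r) (koszul r) _ (@koszul_h j r) (@koszul_h_is_linear j r).

(** By this homotopy every element of the ideal generated by the [l j] kills the homology. It
    disposes of those terms of the sequence that lie in this ideal. *)
Lemma koszul_homotopy j r (z : koszul r) : (j < r)%N ->
  koszul_d (koszul_h j z) + koszul_h j (koszul_d z) = l j *: z.
Proof.
elim: r z => [|r IH] //= [a b] /=; rewrite ltnS leq_eqVlt.
have [->|ne_jr] /= := eqVneq j r => [_|lt_jr].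
  by apply: injective_projections; rewrite /= ?linear0 ?add0r ?addr0 // addKr.
apply: injective_projections; rewrite /=.
  by rewrite linearD linearZ /= scalerN addrACA addNr addr0 IH.
by rewrite linearN [koszul_h _ (- _)]linearN /= !opprK IH.
Qed.

Fixpoint koszul_of_scalar r (s : S) : koszul r :=
  if r is r'.+1 return koszul r then (koszul_of_scalar r' s, 0) else s.

Lemma koszul_of_scalarD r s t :
  koszul_of_scalar r (s + t) = koszul_of_scalar r s + koszul_of_scalar r t.
Proof.
by elim: r => [|r IH] //=; rewrite IH; apply: injective_projections; rewrite /= ?addr0.
Qed.

Lemma koszul_of_scalarZ r a s : koszul_of_scalar r (a * s) = a *: koszul_of_scalar r s.
Proof.
by elim: r => [|r IH] //=; rewrite IH; apply: injective_projections; rewrite /= ?scaler0.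
Qed.

Lemma koszul_of_scalar_inj r : injective (koszul_of_scalar r).
Proof. by elim: r => [|r IH] //= x y [/IH]. Qed.

Lemma koszul_d_scalar r s : koszul_d (koszul_of_scalar r s) = 0.
Proof. by elim: r => [|r IH] //=; rewrite IH scaler0 addr0 linear0 oppr0. Qed.

Section Grading.
(* [D0 e] are the scalars of degree [e], and [dg j] is the degree of [l j]. *)
Variables (D0 : int -> S -> Prop) (dg : nat -> int).

(** The last generator has homological degree 1 and internal degree [dg r'], so that the
    differential preserves internal degrees. *)
Fixpoint koszul_piece r p e : koszul r -> Prop :=
  if r is r'.+1 return koszul r -> Prop
  then fun z => koszul_piece p e z.1 /\
    if p is p'.+1 then koszul_piece p' (e - dg r') z.2 else z.2 = 0
  else fun s => if p is 0 then D0 e s else s = 0.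

Hypothesis D00 : forall e, D0 e 0.
Hypothesis D0B : forall e x y, D0 e x -> D0 e y -> D0 e (x - y).

Lemma koszul_piece0 r p e : koszul_piece p e (0 : koszul r).
Proof. by elim: r p e => [|r IH] [|p] e //=; split=> //; apply: IH. Qed.

Lemma koszul_pieceB r p e (x y : koszul r) :
  koszul_piece p e x -> koszul_piece p e y -> koszul_piece p e (x - y).
Proof.
elim: r p e x y => [|r IH] [|p] e x y /=; first exact: D0B.
- by move=> -> ->; rewrite subr0.
- by move=> [? ->] [? ->]; rewrite subr0; split=> //; apply: IH.
- by move=> [? ?] [? ?]; split; apply: IH.
Qed.

Lemma koszul_pieceN r p e (x : koszul r) :
  koszul_piece p e x -> koszul_piece p e (- x).
Proof. by move=> Dx; rewrite -sub0r; apply: koszul_pieceB => //; apply: koszul_piece0. Qed.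

Lemma koszul_pieceD r p e (x y : koszul r) :
  koszul_piece p e x -> koszul_piece p e y -> koszul_piece p e (x + y).
Proof.
by move=> Dx Dy; rewrite -[y]opprK; apply: koszul_pieceB => //; apply: koszul_pieceN.
Qed.

Lemma koszul_pieceZ r p e k s (x : koszul r) :
  (forall e y, D0 e y -> D0 (e + k) (s * y)) ->
  koszul_piece p e x -> koszul_piece p (e + k) (s *: x).
Proof.
move=> Ds; elim: r p e x => [|r IH] [|p] e x /=; first exact: Ds.
- by move=> ->; rewrite scaler0.
- by move=> [? ->]; rewrite scaler0; split=> //; apply: IH.
- by move=> [? ?]; split; [apply: IH|rewrite addrAC; apply: IH].
Qed.

Lemma koszul_d_piece0 r e (z : koszul r) : koszul_piece 0 e z -> koszul_d z = 0.
Proof.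
elim: r z => [|r IH] //= z [D1 ->].
by rewrite IH // scaler0 addr0 linear0 oppr0.
Qed.

Lemma koszul_d_piece r p e (z : koszul r) :
  (forall j e y, (j < r)%N -> D0 e y -> D0 (e + dg j) (l j * y)) ->
  koszul_piece p.+1 e z -> koszul_piece p e (koszul_d z).
Proof.
elim: r p e z => [|r IH] p e z Dl; first by move=> _; apply: koszul_piece0.
have Dl' j e' y (lt_jr : (j < r)%N) := Dl j e' y (ltnW lt_jr).
move=> /= [D1 D2]; split.
  apply: koszul_pieceD; first exact: IH.
  by rewrite -[e](subrK (dg r)); apply: koszul_pieceZ => // e' y; apply: Dl.
case: p D1 D2 => [|p] D1 D2; last by apply: koszul_pieceN; apply: IH.
by rewrite (koszul_d_piece0 D2) oppr0.
Qed.

Lemma koszul_h_piece j r p e (z : koszul r) : (j < r)%N ->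
  koszul_piece p e z -> koszul_piece p.+1 (e + dg j) (koszul_h j z).
Proof.
elim: r p e z => [|r IH] p e z //=; rewrite ltnS leq_eqVlt.
have [->|ne_jr] /= := eqVneq j r => [_ [D1 _]|lt_jr].
  by split=> /=; [apply: koszul_piece0|rewrite addrK].
move=> [D1 D2]; split=> /=; first exact: IH.
case: p D1 D2 => [|p] D1 D2.
  by rewrite D2 linear0 oppr0; apply: koszul_piece0.
by apply: koszul_pieceN; rewrite addrAC; apply: IH.
Qed.

Lemma koszul_piece_gt r p e (z : koszul r) : (r < p)%N -> koszul_piece p e z -> z = 0.
Proof.
elim: r p e z => [|r IH] [|p] e z //= lt_rp [D1 D2].
apply: injective_projections => /=; first by apply: IH D1; exact: ltnW.
exact: IH D2.
Qed.

Lemma koszul_piece_scalar r e s : D0 e s -> koszul_piece 0 e (koszul_of_scalar r s).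
Proof. by elim: r => [|r IH] //= Ds; split=> //; apply: IH. Qed.

Lemma koszul_piece0_scalar r e (z : koszul r) :
  koszul_piece 0 e z -> exists2 s, D0 e s & z = koszul_of_scalar r s.
Proof.
elim: r z => [|r IH] z /=; first by exists z.
by case=> /IH[s Ds zE] z2; exists s => //; case: z zE z2 => a b /= -> ->.
Qed.

Lemma koszul_d1 r e (z : koszul r) : koszul_piece 1 e z ->
  exists c : nat -> S, koszul_d z = koszul_of_scalar r (\sum_(j < r) c j * l j).
Proof.
elim: r z => [|r IH] z /=; first by exists (fun=> 0); rewrite big_ord0.
case=> /IH[c zE] D2; have [s _ sE] := koszul_piece0_scalar D2.
exists (fun j => if (j < r)%N then c j else s).
rewrite big_ord_recr /= ltnn koszul_of_scalarD zE [s * _]mulrC koszul_of_scalarZ -sE.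
rewrite (koszul_d_piece0 D2) oppr0; congr (koszul_of_scalar _ _ + _, _).
by apply: eq_bigr => j _; rewrite ltn_ord.
Qed.

End Grading.

Section Coefficients.
Implicit Types J : S -> Prop.

Fixpoint koszul_in J r : koszul r -> Prop :=
  if r is r'.+1 return koszul r -> Prop
  then fun z => koszul_in J z.1 /\ koszul_in J z.2 else J.

Lemma koszul_in_sub J J' r (z : koszul r) :
  (forall s, J s -> J' s) -> koszul_in J z -> koszul_in J' z.
Proof. by move=> JJ'; elim: r z => [|r IH] z /=; [apply: JJ'|case=> /IH ? /IH ?]. Qed.

Lemma koszul_in_eq0 r (z : koszul r) : koszul_in (fun s => s = 0) z -> z = 0.
Proof. by elim: r z => [|r IH] //= [a b] /= [/IH-> /IH->]. Qed.

Section Ideal.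
Variable J : S -> Prop.
Hypothesis Jid : is_ideal J.

Let J0 : J 0. Proof. by case: Jid. Qed.
Let JD a b : J a -> J b -> J (a + b). Proof. by case: Jid => _ H _; apply: H. Qed.
Let JM a b : J b -> J (a * b). Proof. by case: Jid => _ _ H; apply: H. Qed.

Lemma koszul_in0 r : koszul_in J (0 : koszul r).
Proof. by elim: r => //= r IH; split. Qed.

Lemma koszul_inD r (x y : koszul r) :
  koszul_in J x -> koszul_in J y -> koszul_in J (x + y).
Proof. by elim: r x y => [|r IH] x y /=; [exact: JD|case=> ? ? [? ?]; split; apply: IH]. Qed.

Lemma koszul_inZ r s (x : koszul r) : koszul_in J x -> koszul_in J (s *: x).
Proof. by elim: r x => [|r IH] x /=; [exact: JM|case=> ? ?; split; apply: IH]. Qed.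

Lemma koszul_inB r (x y : koszul r) :
  koszul_in J x -> koszul_in J y -> koszul_in J (x - y).
Proof. by move=> Jx Jy; rewrite -scaleN1r; apply: koszul_inD => //; apply: koszul_inZ. Qed.

Lemma koszul_in_of_mem r s (x : koszul r) : J s -> koszul_in J (s *: x).
Proof.
move=> Js; elim: r x => [|r IH] x /=; last by split; apply: IH.
by rewrite [_ *: _]mulrC; apply: JM.
Qed.

Lemma koszul_in_d r (x : koszul r) : koszul_in J x -> koszul_in J (koszul_d x).
Proof.
elim: r x => [|r IH] x //= [Ja Jb]; split.
  by apply: koszul_inD; [apply: IH|apply: koszul_inZ].
by rewrite -scaleN1r; apply: koszul_inZ; apply: IH.
Qed.

End Ideal.

Variables (D0 : int -> S -> Prop) (dg : nat -> int).

Lemma koszul_in_regular J r p e f (x : koszul r) : J 0 ->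
  (forall e s, D0 e s -> J (f * s) -> J s) ->
  koszul_piece D0 dg p e x -> koszul_in J (f *: x) -> koszul_in J x.
Proof.
move=> J0 reg.
have z0 n : koszul_in J (0 : koszul n) by elim: n => //= n; split.
elim: r p e x => [|r IH] [|p] e x /=; [exact: reg| by move=> -> |..].
  by case=> Da ->; case=> Ja _; split; [apply: IH Da Ja|].
by case=> Da Db [Ja Jb]; split; [apply: IH Da Ja|apply: IH Db Jb].
Qed.

(** The complex is free, so the decomposition is made coefficient by coefficient. The two components
    come with different denominators u and u', and each witness is multiplied by the denominator of
    the other. *)
Lemma koszul_in_decomp (U J J' : S -> Prop) f r p e (x : koszul r) :
  is_ideal J -> mul_closed U -> (forall e, D0 e 0) ->
  (forall u e s, U u -> D0 e s -> D0 e (u * s)) ->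
  (forall e s, D0 (e + 1) s -> J' s ->
     exists u v, [/\ U u, D0 e v & J (u * s - f * v)]) ->
  koszul_piece D0 dg p (e + 1) x -> koszul_in J' x ->
  exists u v, [/\ U u, koszul_piece D0 dg p e v & koszul_in J (u *: x - f *: v)].
Proof.
move=> Jid [U1 UM] D00 DU dec.
have DUZ n p' e' u (y : koszul n) : U u -> koszul_piece D0 dg p' e' y ->
    koszul_piece D0 dg p' e' (u *: y).
  by move=> Uu Dy; rewrite -[e']addr0; apply: koszul_pieceZ Dy => // e2 s ?;
     rewrite addr0; apply: DU.
elim: r p e x => [|r IH] [|p] e x /=; first exact: dec.
- by move=> -> _; exists 1, 0; rewrite !scaler0 subr0; split=> //; exact: (koszul_in0 Jid 0).
- case=> Da -> [Ja _]; have [u [v [Uu Dv Jv]]] := IH _ _ _ Da Ja.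
  exists u, (v, 0); split=> //=; split=> //=.
  by rewrite !scaler0 subr0; apply: koszul_in0.
- case=> Da Db [Ja Jb]; have [u [v [Uu Dv Jv]]] := IH _ _ _ Da Ja.
  rewrite addrAC in Db; have [u' [v' [Uu' Dv' Jv']]] := IH _ _ _ Db Jb.
  exists (u * u'), (u' *: v, u *: v'); split; first exact: UM.
    by split; apply: DUZ.
  split=> /=.
    have := koszul_inZ Jid u' Jv.
    by rewrite scalerBr !scalerA [u' * u]mulrC [u' * f]mulrC.
  have := koszul_inZ Jid u Jv'.
  by rewrite scalerBr !scalerA [u * f]mulrC.
Qed.

End Coefficients.
End KoszulComplex.

(** * Triangular sequences *)

Section LocalSpan.
Variables (S : comNzRingType) (U : S -> Prop) (f : nat -> S).
Hypothesis U_mul : mul_closed U.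

(* The ideal [(f 0, ..., f (i-1))] of the localization at [U], contracted to [S]. *)
Definition local_span i (s : S) : Prop :=
  exists u (c : nat -> S), U u /\ u * s = \sum_(j < i) c j * f j.

Lemma local_span_ideal i : is_ideal (local_span i).
Proof.
have [U1 UM] := U_mul; split.
- by exists 1, (fun=> 0); split=> //; rewrite mulr0 big1 // => j _; rewrite mul0r.
- move=> a b [u [c [Uu ua]]] [v [e [Uv vb]]].
  exists (u * v), (fun j => v * c j + u * e j); split; first exact: UM.
  rewrite mulrDr -mulrA [v * a]mulrC mulrA ua -mulrA vb mulr_suml mulr_sumr -big_split.
  by apply: eq_bigr => j _ /=; ring.
- move=> r a [u [c [Uu ua]]]; exists u, (fun j => r * c j); split=> //.
  by rewrite mulrCA ua mulr_sumr; apply: eq_bigr => j _; rewrite mulrA.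
Qed.

Lemma local_span_succ i s : local_span i s -> local_span i.+1 s.
Proof.
move=> [u [c [Uu us]]]; exists u, (fun j => if (j < i)%N then c j else 0); split=> //.
rewrite us big_ord_recr /= ltnn mul0r addr0.
by apply: eq_bigr => j _; rewrite ltn_ord.
Qed.

Lemma local_span_gen i : local_span i.+1 (f i).
Proof.
have [U1 _] := U_mul; exists 1, (fun j => (j == i)%:R); split=> //.
rewrite big_ord_recr /= eqxx big1 ?add0r // => j _.
by rewrite ltn_eqF ?ltn_ord // mul0r.
Qed.

Lemma local_span_decomp i s : local_span i.+1 s ->
  exists u v, U u /\ local_span i (u * s - f i * v).
Proof.
have [U1 _] := U_mul.
move=> [u [c [Uu us]]]; exists u, (c i); split=> //; exists 1, c; split=> //.
by rewrite us big_ord_recr /= mul1r [f i * _]mulrC addrK.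
Qed.

End LocalSpan.

Section Triangular.
Variable S : idomainType.

(* [theta] views [S] as a polynomial ring in its variable [y]. *)
Definition separates (theta : {rmorphism S -> {poly S}}) (y : S) : Prop :=
  [/\ forall s, (theta s).[y] = s, theta y = 'X
    & forall s i, theta (theta s)`_i = ((theta s)`_i)%:P].

(** Leading terms are cancelled in S itself, by [s']. The coefficients of [theta s] and [theta f]
    are constants for theta, so theta turns [s'] into the usual cancellation between polynomials. *)
Lemma pseudo_division (theta : {rmorphism S -> {poly S}}) y f : separates theta y ->
  f != 0 -> forall s, exists (N : nat) q r,
  lead_coef (theta f) ^+ N * s = q * f + r /\ (size (theta r) < size (theta f))%N.
Proof.
move=> [ev_y theta_y coef_free] f0.
have tf0 : theta f != 0.
  by apply: contraNneq f0 => tf0; rewrite -(ev_y f) tf0 horner0.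
move=> s; have [n] := ubnP (size (theta s)); elim: n s => // n IH s lt_s.
have [lt_sf|le_fs] := ltnP (size (theta s)) (size (theta f)).
  by exists 0%N, 0, s; rewrite expr0 mul1r mul0r add0r.
set delta := lead_coef (theta f); set e := lead_coef (theta s).
have [k kE] : exists k, k = (size (theta s) - size (theta f))%N by eexists.
pose s' := delta * s - e * y ^+ k * f.
have szf : (0 < size (theta f))%N by rewrite size_poly_gt0.
have lt_s' : (size (theta s') < n)%N.
  suff : (size (theta s') <= (size (theta s)).-1)%N by lia.
  have -> : theta s' = delta%:P * theta s - e%:P * 'X^k * theta f.
    by rewrite rmorphB !rmorphM rmorphXn /= theta_y /delta /e /lead_coef !coef_free.
  apply/leq_sizeP => j le_j.
  rewrite coefB -mulrA mulrC coefMC mulrC [e%:P * _]mulrC coefMC coefXnM.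
  have [lt_jk|le_kj] := ltnP j k; first by lia.
  have [jE|ne_j] := eqVneq j (size (theta s)).-1.
    have -> : (j - k)%N = (size (theta f)).-1 by lia.
    by rewrite jE -!lead_coefE -/delta -/e mulrC subrr.
  have le_sj : (size (theta s) <= j)%N by lia.
  have le_fj : (size (theta f) <= j - k)%N by lia.
  by rewrite (nth_default _ le_sj) (nth_default _ le_fj) mulr0 mul0r subr0.
have [N [q [r [eq_s' lt_r]]]] := IH s' lt_s'.
exists N.+1, (q + delta ^+ N * e * y ^+ k), r; split=> //.
rewrite exprSr -mulrA -[delta * s](subrK (e * y ^+ k * f)) -/s' mulrDr eq_s'.
by ring.
Qed.

Variables (U : S -> Prop) (f : nat -> S) (c : nat).
Hypothesis U_mul : mul_closed U.
Hypothesis U0 : ~ U 0.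

Definition triangular : Prop := forall i, (i < c)%N -> exists theta y,
  [/\ separates theta y, (forall j, (j < i)%N -> theta (f j) = (f j)%:P)
    & U (lead_coef (theta (f i)))].

Lemma local_span0 s : local_span U f 0 s -> s = 0.
Proof.
move=> [u [e [Uu]]]; rewrite big_ord0 => /eqP; rewrite mulf_eq0 => /orP[/eqP u0|/eqP //].
by rewrite u0 in Uu.
Qed.

(* Dividing the coefficients of a relation [f i * s = \sum_(j < i) c j * f j] by [f i]
   leaves a remainder of smaller degree in the new variable, which must vanish. *)
Lemma triangular_regular i s : triangular -> (i < c)%N ->
  local_span U f i (f i * s) -> local_span U f i s.
Proof.
move=> tri lt_ic [u [e [Uu us]]].
have [theta [y [sep fj Udelta]]] := tri i lt_ic.
have [ev_y theta_y coef_free] := sep.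
have [U1 UM] := U_mul.
set delta := lead_coef _ in Udelta.
have fi0 : f i != 0.
  by apply/eqP => fi0; move: Udelta; rewrite /delta fi0 rmorph0 lead_coef0.
have theta_inj x : theta x = 0 -> x = 0 by move=> x0; rewrite -(ev_y x) x0 horner0.
have theta_delta N : theta (delta ^+ N) = (delta ^+ N)%:P.
  by rewrite !rmorphXn /= /delta /lead_coef coef_free.
have UX N : U (delta ^+ N) by elim: N => [|N IH]; rewrite ?expr0 // exprS; apply: UM.
have division n : (n <= i)%N -> exists (N : nat) q r,
    [/\ delta ^+ N * \sum_(j < n) e j * f j = q * f i + r,
        exists c' : nat -> S, q = \sum_(j < n) c' j * f j
      & (size (theta r) < size (theta (f i)))%N].
  elim: n => [|n IH] le_n.
    exists 0%N, 0, 0; rewrite !big_ord0 mulr0 mul0r addr0; split=> //.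
      by exists (fun=> 0); rewrite big_ord0.
    rewrite rmorph0 size_poly0 size_poly_gt0; apply: contraNneq fi0 => /theta_inj ->//.
  have [N [q [r [eqN [c' qE] lt_r]]]] := IH (ltnW le_n).
  have [M [q' [r' [eqM lt_r']]]] := pseudo_division sep fi0 (e n).
  exists (N + M)%N, (delta ^+ M * q + delta ^+ N * q' * f n),
    (delta ^+ M * r + delta ^+ N * r' * f n); split.
  - rewrite big_ord_recr /= mulrDr exprD.
    transitivity (delta ^+ M * (q * f i + r) + delta ^+ N * (q' * f i + r') * f n).
      by rewrite -eqN -eqM; ring.
    by ring.
  - exists (fun j => if (j < n)%N then delta ^+ M * c' j else delta ^+ N * q').
    rewrite big_ord_recr /= ltnn qE mulr_sumr; congr (_ + _).
    by apply: eq_bigr => j _; rewrite ltn_ord mulrA.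
  (* The earlier term [f n] and the powers of [delta] are constants for theta, so multiplying
     remainders by them does not raise the degree. *)
  - rewrite rmorphD !rmorphM /= !theta_delta fj //.
    rewrite (leq_ltn_trans (size_polyD _ _)) // gtn_max; apply/andP; split.
      by rewrite mul_polyC (leq_ltn_trans (size_scale_leq _ _)).
    rewrite mulrC !mul_polyC (leq_ltn_trans (size_scale_leq _ _)) //.
    by rewrite (leq_ltn_trans (size_scale_leq _ _)).
have [N [q [r [eqN [c' qE] lt_r]]]] := division i (leqnn i).
have eq_r : (delta ^+ N * u * s - q) * f i = r.
  by apply: (addrI (q * f i)); rewrite -eqN -us; ring.
have z0 : delta ^+ N * u * s - q = 0.
  apply/eqP; apply: contraTT lt_r => nz; rewrite -leqNgt -eq_r rmorphM /=.
  rewrite size_mul; first last.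
  - by apply: contraNneq fi0 => /theta_inj ->.
  - by apply: contraNneq nz => /theta_inj ->.
  rewrite -subn1 -addnBAC; first by rewrite leq_addl.
  by rewrite size_poly_gt0; apply: contraNneq nz => /theta_inj ->.
exists (delta ^+ N * u), c'; split; first exact: UM.
by rewrite -qE; apply/eqP; rewrite -subr_eq0 z0.
Qed.

End Triangular.

(** * Views of a polynomial ring as univariate polynomials *)

Section Variables.
Variables (A : comNzRingType) (n : nat).

Lemma mpoly_gen_ind (P : {mpoly A[n]} -> Prop) :
  (forall c, P c%:MP) -> (forall i, P 'X_i) ->
  (forall p q, P p -> P q -> P (p + q)) -> (forall p q, P p -> P q -> P (p * q)) ->
  forall p, P p.
Proof.
move=> PC PX PD PM p; elim/mpolyind: p => [|c m p _ _ Pp]; first by rewrite -mpolyC0.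
apply: PD => //; rewrite -mul_mpolyC; apply: (PM) => //; rewrite mpolyXE_id.
apply: (big_ind P) => [|x y|i _]; [by rewrite -mpolyC1|exact: PM|].
by elim: (m i) => [|k IH]; rewrite ?expr0 -?mpolyC1 // exprS; apply: (PM).
Qed.

Lemma mpoly_rmorph_eq (B : comNzRingType) (f g : {rmorphism {mpoly A[n]} -> B}) :
  (forall c, f c%:MP = g c%:MP) -> (forall i, f 'X_i = g 'X_i) -> f =1 g.
Proof.
move=> fgC fgX p; elim/mpoly_gen_ind: p => // p q IHp IHq; first by rewrite !rmorphD IHp IHq.
by rewrite !rmorphM /= IHp IHq.
Qed.

(** The coefficients stay in the full ring instead of the ring in the other variables; views in
    different variables can then be composed and compared. *)
Definition var_poly (i : 'I_n) : {mpoly A[n]} -> {poly {mpoly A[n]}} :=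
  mmap (polyC \o @mpolyC n A) (fun j => if j == i then 'X else ('X_j)%:P).

HB.instance Definition _ i := GRing.RMorphism.on (var_poly i).

Lemma var_polyC i c : var_poly i c%:MP = (c%:MP)%:P.
Proof. by rewrite /var_poly mmapC. Qed.

Lemma var_polyX i : var_poly i 'X_i = 'X.
Proof. by rewrite /var_poly mmapX mmap1U eqxx. Qed.

Lemma var_polyXn i j : j != i -> var_poly i 'X_j = ('X_j)%:P.
Proof. by move=> ne_ji; rewrite /var_poly mmapX mmap1U (negbTE ne_ji). Qed.

End Variables.

Section CoefFree.
Variables (S : comNzRingType) (theta : {rmorphism S -> {poly S}}).

Definition coef_free a := forall i, theta (theta a)`_i = ((theta a)`_i)%:P.

Lemma coef_freeD a b : coef_free a -> coef_free b -> coef_free (a + b).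
Proof. by move=> Fa Fb i; rewrite rmorphD coefD rmorphD /= Fa Fb polyCD. Qed.

Lemma coef_freeM a b : coef_free a -> coef_free b -> coef_free (a * b).
Proof.
move=> Fa Fb i; rewrite rmorphM coefM rmorph_sum rmorph_sum /=; apply: eq_bigr => j _.
by rewrite rmorphM /= Fa Fb polyCM.
Qed.

End CoefFree.

Lemma separates_var_poly (A : idomainType) n (i : 'I_n) :
  separates (var_poly (A := A) i) 'X_i.
Proof.
split.
- move=> s; rewrite -[RHS]/(idfun s) -[LHS]/((horner_eval 'X_i \o var_poly i) s).
  apply: mpoly_rmorph_eq => [c|j] /=; first by rewrite /horner_eval var_polyC hornerC.
  rewrite /horner_eval; have [->|ne_ji] := eqVneq j i; first by rewrite var_polyX hornerX.
  by rewrite var_polyXn // hornerC.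
- exact: var_polyX.
- suff all_free : forall p : {mpoly A[n]}, coef_free (var_poly i) p by move=> s; exact: all_free.
  elim/mpoly_gen_ind => [c|j|p q Fp Fq|p q Fp Fq].
  + by move=> a; rewrite /= var_polyC coefC; case: eqP => _; rewrite ?var_polyC ?rmorph0.
  + move=> a; rewrite /=; have [->|ne_ji] := eqVneq j i.
      by rewrite var_polyX coefX; case: (a == 1)%N; rewrite ?rmorph1 ?rmorph0 ?polyC1 ?polyC0.
    by rewrite var_polyXn // coefC; case: eqP => _; rewrite ?rmorph0 ?var_polyXn.
  + exact: coef_freeD.
  + exact: coef_freeM.
Qed.

Section Lift.
Variables (A : idomainType) (m : nat) (theta : {rmorphism A -> {poly A}}) (y : A).

(** Theta is applied to the coefficients, and the new variables become constants. This serves twice: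
    it lifts a view in a variable of the base ring, and it lifts a grading of the base ring, the new
    variables having degree 0. *)
Definition lift_separation : {mpoly A[m]} -> {poly {mpoly A[m]}} :=
  mmap (map_poly (@mpolyC m A) \o theta) (fun j => ('X_j)%:P).

HB.instance Definition _ := GRing.RMorphism.on lift_separation.

Lemma lift_separationC c : lift_separation c%:MP = map_poly (@mpolyC m A) (theta c).
Proof. by rewrite /lift_separation mmapC. Qed.

Lemma lift_separationX j : lift_separation 'X_j = ('X_j)%:P.
Proof. by rewrite /lift_separation mmapX mmap1U. Qed.

Lemma separates_lift : separates theta y -> separates lift_separation y%:MP.
Proof.
move=> [ev_y theta_y coefE]; split.
- move=> s; rewrite -[RHS]/(idfun s) -[LHS]/((horner_eval y%:MP \o lift_separation) s).
  apply: mpoly_rmorph_eq => [c|j] /=; rewrite /horner_eval.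
    by rewrite lift_separationC horner_map /= ev_y.
  by rewrite lift_separationX hornerC.
- by rewrite /= lift_separationC theta_y map_polyX.
- suff all_free : forall p : {mpoly A[m]}, coef_free lift_separation p by move=> s; exact: all_free.
  elim/mpoly_gen_ind => [c|j|p q Fp Fq|p q Fp Fq].
  + by move=> a; rewrite /= !lift_separationC coef_map /= lift_separationC /= coefE map_polyC.
  + move=> a; rewrite /= lift_separationX coefC.
    by case: eqP => _; rewrite ?rmorph0 ?lift_separationX.
  + exact: coef_freeD.
  + exact: coef_freeM.
Qed.

End Lift.

(** Taking coefficients in two different variables commutes. Hence the coefficients of f in X_i are
    free of X_j whenever f is, which is [in_vars_coef]. *)
Lemma swap_var_poly (A : comNzRingType) n (i j : 'I_n) (p : {mpoly A[n]}) : i != j ->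
  map_poly (var_poly j) (var_poly i p) = swapXY (map_poly (var_poly i) (var_poly j p)).
Proof.
move=> ne_ij.
rewrite -[LHS]/((map_poly (var_poly j) \o var_poly i) p).
rewrite -[RHS]/((swapXY \o (map_poly (var_poly i) \o var_poly j)) p).
apply: mpoly_rmorph_eq => [c|a] /=.
  by rewrite !var_polyC !map_polyC /= !var_polyC swapXY_polyC map_polyC.
have [->|ne_ai] := eqVneq a i.
  rewrite var_polyX var_polyXn // map_polyX map_polyC /= var_polyX.
  by rewrite swapXY_polyC map_polyX.
rewrite var_polyXn // map_polyC /=.
have [->|ne_aj] := eqVneq a j; last first.
  by rewrite !var_polyXn // map_polyC /= var_polyXn // swapXY_polyC map_polyC.
by rewrite var_polyX map_polyX swapXY_X.
Qed.

(** * Dimension of a prime of a polynomial ring *)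

Section PrimeIdeals.
Variables (R : comNzRingType) (Q : R -> Prop).
Hypothesis Qprime : prime_ideal Q.

Let Qid : is_ideal Q. Proof. by case: Qprime. Qed.

Lemma prime0 : Q 0. Proof. by case: Qid. Qed.
Lemma primeD x y : Q x -> Q y -> Q (x + y). Proof. by case: Qid => _ H _; apply: H. Qed.
Lemma primeMr r x : Q x -> Q (r * x). Proof. by case: Qid => _ _ H; apply: H. Qed.
Lemma primeMl r x : Q x -> Q (x * r). Proof. by rewrite mulrC; apply: primeMr. Qed.
Lemma primeN x : Q x -> Q (- x). Proof. by rewrite -mulN1r; apply: primeMr. Qed.
Lemma primeB x y : Q x -> Q y -> Q (x - y).
Proof. by move=> Qx Qy; apply: primeD => //; apply: primeN. Qed.
Lemma prime_sum I (r : seq I) (P : pred I) F :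
  (forall i, P i -> Q (F i)) -> Q (\sum_(i <- r | P i) F i).
Proof. by move=> QF; apply: big_ind => //; [exact: prime0|exact: primeD]. Qed.
Lemma prime_mul_closed : mul_closed (fun x => ~ Q x).
Proof. by case: Qprime => _ Q1 QM; split=> // a b nQa nQb /QM[]. Qed.
Lemma primeX x n : Q (x ^+ n) -> Q x.
Proof.
case: Qprime => _ Q1 QM; elim: n => [|n IH]; first by rewrite expr0 => /Q1.
by rewrite exprS => /QM[|/IH].
Qed.

End PrimeIdeals.

Section Dimension.
Variables (k : fieldType) (d : nat).
Notation R := {mpoly k[d]}.
Implicit Types (Q P : R -> Prop) (I : {set 'I_d}).

(** The subring of polynomials in the X_i with i in I, described as those constant in every other
    variable, so that all elements remain in R. *)
Definition in_vars I (g : R) : Prop := forall j, j \notin I -> var_poly j g = g%:P.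

Lemma in_varsD I f g : in_vars I f -> in_vars I g -> in_vars I (f + g).
Proof. by move=> If Ig j Ij; rewrite rmorphD /= If // Ig // polyCD. Qed.

Lemma in_varsM I f g : in_vars I f -> in_vars I g -> in_vars I (f * g).
Proof. by move=> If Ig j Ij; rewrite rmorphM /= If // Ig // polyCM. Qed.

Lemma in_varsC I c : in_vars I c%:MP.
Proof. by move=> j _; rewrite var_polyC. Qed.

Lemma in_vars0 I : in_vars I 0. Proof. by rewrite -mpolyC0; apply: in_varsC. Qed.
Lemma in_vars1 I : in_vars I 1. Proof. by rewrite -mpolyC1; apply: in_varsC. Qed.

Lemma in_vars_prod I (T : Type) (r : seq T) (P : pred T) F :
  (forall i, P i -> in_vars I (F i)) -> in_vars I (\prod_(i <- r | P i) F i).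
Proof. by move=> IF; apply: big_ind => //; [exact: in_vars1|exact: in_varsM]. Qed.

Lemma in_varsX I i : i \in I -> in_vars I 'X_i.
Proof. by move=> Ii j Ij; rewrite var_polyXn //; apply: contraNneq Ij => <-. Qed.

Lemma in_vars_coef I i f a : in_vars (i |: I) f -> in_vars I (var_poly i f)`_a.
Proof.
move=> If j Ij; have [->|ne_ji] := eqVneq j i.
  by have [_ _ ->] := separates_var_poly k i.
have := swap_var_poly f (i := i) (j := j); rewrite eq_sym => /(_ ne_ji).
rewrite [var_poly j f]If ?inE ?negb_or ?ne_ji // map_polyC /= swapXY_polyC.
by move/(congr1 (fun p : {poly {poly R}} => p`_a)); rewrite !coef_map.
Qed.

Lemma in_vars_char_poly I N (M : 'M[R]_N) a : (forall i j, in_vars I (M i j)) ->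
  in_vars I (char_poly M)`_a.
Proof.
move=> IM j Ij; have : map_poly (var_poly j) (char_poly M) = map_poly polyC (char_poly M).
  rewrite !map_char_poly; congr char_poly; apply/matrixP => u v.
  by rewrite !mxE; apply: IM.
by move/(congr1 (fun p : {poly {poly R}} => p`_a)); rewrite !coef_map.
Qed.

Definition kill_vars (s : seq 'I_d) : R -> R :=
  mmap (@mpolyC d k) (fun j => if j \in s then 0 else 'X_j).

HB.instance Definition _ s := GRing.RMorphism.on (kill_vars s).

Lemma kill_varsC s c : kill_vars s c%:MP = c%:MP.
Proof. by rewrite /kill_vars mmapC. Qed.

Lemma kill_varsX s j : kill_vars s 'X_j = if j \in s then 0 else 'X_j.
Proof. by rewrite /kill_vars mmapX mmap1U. Qed.

(** Substituting 0 for the variables one after the other does not change a polynomial constant in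
    each of them; once all are replaced, a scalar is left. *)
Lemma in_vars_set0 g : in_vars set0 g -> exists c, g = c%:MP.
Proof.
move=> Ig; have ev_id s : kill_vars s g = g.
  elim: s => [|j s IH].
    rewrite -[RHS]/(idfun g); apply: mpoly_rmorph_eq => [c|j] /=; first exact: kill_varsC.
    by rewrite kill_varsX.
  pose y : R := if j \in j :: s then 0 else 'X_j.
  rewrite -{2}IH; transitivity ((map_poly (kill_vars s) (var_poly j g)).[y]).
    rewrite -[RHS]/((horner_eval y \o (map_poly (kill_vars s) \o var_poly j)) g).
    apply: mpoly_rmorph_eq => [c|i] /=; rewrite /horner_eval.
      by rewrite var_polyC map_polyC hornerC /= !kill_varsC.
    rewrite kill_varsX; have [->|ne_ij] := eqVneq i j.
      by rewrite var_polyX map_polyX hornerX.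
    by rewrite var_polyXn // map_polyC hornerC /= kill_varsX inE (negbTE ne_ij).
  by rewrite Ig ?inE // map_polyC hornerC.
have : exists c, kill_vars (enum 'I_d) g = c%:MP; last by rewrite ev_id.
elim/mpoly_gen_ind: {Ig ev_id} g => [c|i|p q|p q].
- by exists c; rewrite kill_varsC.
- by exists 0; rewrite kill_varsX mem_enum mpolyC0.
- by move=> [a pE] [b qE]; exists (a + b); rewrite mpolyCD -pE -qE rmorphD.
- by move=> [a pE] [b qE]; exists (a * b); rewrite mpolyCM -pE -qE rmorphM.
Qed.

Definition independent_mod Q I : Prop := forall g, in_vars I g -> Q g -> g = 0.

(* The transcendence degree of the fraction field of [R / Q] over [k]. *)
Definition dim_mod Q : nat :=
  \max_(I : {set 'I_d} | boolp.asbool (independent_mod Q I)) #|I|.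

Lemma independent_mod_set0 Q : prime_ideal Q -> independent_mod Q set0.
Proof.
move=> Qprime g /in_vars_set0[c ->] Qc; have [->|c0] := eqVneq c 0; first by rewrite mpolyC0.
have [_ Q1 _] := Qprime; case: Q1.
by rewrite -mpolyC1 -(mulVf c0) mpolyCM; apply: primeMr.
Qed.

Lemma leq_dim_mod Q I : independent_mod Q I -> (#|I| <= dim_mod Q)%N.
Proof.
by move=> QI; apply: (@leq_bigmax_cond _ _ (fun J : {set 'I_d} => #|J|)); apply/boolp.asboolP.
Qed.

Lemma dim_mod_le Q : (dim_mod Q <= d)%N.
Proof.
by apply/bigmax_leqP => I _; rewrite (leq_trans (max_card _)) // card_ord.
Qed.

Lemma dim_mod_basis Q : prime_ideal Q -> exists2 I, independent_mod Q I & #|I| = dim_mod Q.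
Proof.
move=> Qprime.
have [|I QI IE] := @eq_bigmax_cond _ (fun I => boolp.asbool (independent_mod Q I))
    (fun J : {set 'I_d} => #|J|).
  by apply/card_gt0P; exists set0; apply/boolp.asboolP; apply: independent_mod_set0.
by exists I; [apply/boolp.asboolP|rewrite /dim_mod IE].
Qed.

Lemma dim_mod_dependent Q I i :
  #|I| = dim_mod Q -> i \notin I -> exists f, [/\ in_vars (i |: I) f, Q f & f != 0].
Proof.
move=> cardI Ii; apply: boolp.contrapT => nex.
suff /leq_dim_mod : independent_mod Q (i |: I) by rewrite cardsU1 Ii -cardI ltnn.
by move=> g Ig Qg; apply/eqP; apply: contra_notT nex => g0; exists g.
Qed.

Lemma independent_mod_sub Q P I : subI Q P -> independent_mod P I -> independent_mod Q I.
Proof. by move=> QP PI g Ig /QP; apply: PI. Qed.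

End Dimension.

Section FiniteRank.
Variables (k : fieldType) (d : nat) (Q : {mpoly k[d]} -> Prop) (I : {set 'I_d}).
Notation R := {mpoly k[d]}.
Hypothesis Qprime : prime_ideal Q.
Hypothesis Qdim : #|I| = dim_mod Q.

(** Multiplying a relation by a power of its variable raises its degree, so one degree D + 1 serves
    for all variables outside I. The monomials with exponents at most D then suffice in
    [finite_rank]. *)
Lemma uniform_relation : exists D, forall i, i \notin I -> exists p : {poly R},
  [/\ forall a, in_vars I p`_a, size p = D.+2 & Q p.['X_i]].
Proof.
pose rel i D := exists p : {poly R},
  [/\ forall a, in_vars I p`_a, size p = D.+1 & Q p.['X_i]].
have rel_shift i D D' : (D <= D')%N -> rel i D -> rel i D'.
  move=> /subnK <-; elim: (D' - D)%N => [|e IH] // /IH[p [pI szp Qp]].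
  exists (p * 'X); split.
  - move=> a; rewrite coefMX; case: eqP => _; [exact: in_vars0|exact: pI].
  - by rewrite size_mulX ?szp // -size_poly_eq0 szp.
  - by rewrite hornerMX; apply: primeMl.
have rel_ex i : i \notin I -> exists D, rel i D.
  move=> Ii; have [f [If Qf f0]] := dim_mod_dependent Qdim Ii.
  have [ev _ _] := separates_var_poly k i.
  exists (size (var_poly i f)).-1, (var_poly i f); split.
  - by move=> a; apply: in_vars_coef.
  - rewrite prednK // size_poly_gt0; apply: contraNneq f0 => tf0.
    by rewrite -(ev f) /= tf0 horner0.
  - by rewrite ev.
have [D relD] : exists D, forall i, i \in enum 'I_d -> i \notin I -> rel i D.
  elim: (enum 'I_d) => [|i s [D IH]]; first by exists 0%N.
  have [Ii|Ii] := boolP (i \in I).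
    exists D => j; rewrite inE => /orP[/eqP ->|js Ij]; first by rewrite Ii.
    exact: IH.
  have [D' reli] := rel_ex i Ii; exists (maxn D D') => j.
  rewrite inE => /orP[/eqP -> _|js Ij]; first exact: rel_shift (leq_maxr _ _) reli.
  exact: rel_shift (leq_maxl _ _) (IH j js Ij).
by exists D => i Ii; apply: (rel_shift i D D.+1 (leqnSn _)); apply: relD; rewrite ?mem_enum.
Qed.

Section Span.
Variables (T : finType) (e : T -> R).

(** Modulo Q, g lies in the span of the [e b] over the field of fractions of the polynomial ring in
    the variables I; [delta] clears the denominators. *)
Definition rank_span (g : R) : Prop := exists (delta : R) (c : T -> R),
  [/\ in_vars I delta, delta != 0, forall b, in_vars I (c b)
    & Q (delta * g - \sum_b c b * e b)].

Lemma rank_spanE b : rank_span (e b).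
Proof.
exists 1, (fun b' => (b' == b)%:R); split.
- exact: in_vars1.
- exact: oner_neq0.
- by move=> b'; case: eqP => _; [exact: in_vars1|exact: in_vars0].
- rewrite mul1r (bigD1 b) //= eqxx mul1r big1 ?addr0 ?subrr; first exact: prime0.
  by move=> b' /negbTE ->; rewrite mul0r.
Qed.

Lemma rank_span0 : rank_span 0.
Proof.
exists 1, (fun=> 0); split; [exact: in_vars1|exact: oner_neq0|by move=> _; exact: in_vars0|].
rewrite mulr0 big1 ?subrr; first exact: prime0.
by move=> b _; rewrite mul0r.
Qed.

Lemma rank_spanD g h : rank_span g -> rank_span h -> rank_span (g + h).
Proof.
move=> [u [a [Iu u0 Ia Qa]]] [v [b [Iv v0 Ib Qb]]].
exists (u * v), (fun x => v * a x + u * b x); split.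
- exact: in_varsM.
- exact: mulf_neq0.
- by move=> x; apply: in_varsD; apply: in_varsM.
- have := primeD Qprime (primeMr Qprime v Qa) (primeMr Qprime u Qb); congr Q.
  under [in RHS]eq_bigr do rewrite mulrDl -!mulrA.
  by rewrite big_split /= -!mulr_sumr; ring.
Qed.

Lemma rank_spanM f g : in_vars I f -> rank_span g -> rank_span (f * g).
Proof.
move=> If [u [a [Iu u0 Ia Qa]]]; exists u, (fun x => f * a x); split=> //.
  by move=> b; apply: in_varsM.
have := primeMr Qprime f Qa; congr Q.
under [in RHS]eq_bigr do rewrite -!mulrA.
by rewrite -!mulr_sumr; ring.
Qed.

Lemma rank_span_scaled f g : in_vars I f -> f != 0 -> rank_span (f * g) -> rank_span g.
Proof.
move=> If f0 [u [a [Iu u0 Ia Qa]]]; exists (u * f), a; split=> //.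
- exact: in_varsM.
- exact: mulf_neq0.
- by rewrite -mulrA.
Qed.

Lemma rank_span_congr g h : Q (g - h) -> rank_span g -> rank_span h.
Proof.
move=> Qgh [u [a [Iu u0 Ia Qa]]]; exists u, a; split=> //.
by have := primeB Qprime Qa (primeMr Qprime u Qgh); congr Q; ring.
Qed.

Lemma rank_span_sum (J : Type) (r : seq J) (P : pred J) F :
  (forall j, P j -> rank_span (F j)) -> rank_span (\sum_(j <- r | P j) F j).
Proof. by move=> FP; apply: big_ind => //; [exact: rank_span0|exact: rank_spanD]. Qed.

Lemma rank_span_closed f : (forall b, rank_span (f * e b)) ->
  forall g, rank_span g -> rank_span (f * g).
Proof.
move=> fe g [u [a [Iu u0 Ia Qa]]]; apply: (rank_span_scaled Iu u0).
apply: (rank_span_congr (g := \sum_b a b * (f * e b))).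
  have := primeN Qprime (primeMr Qprime f Qa); congr Q.
  under [in RHS]eq_bigr do rewrite mulrCA.
  by rewrite -mulr_sumr; ring.
by apply: rank_span_sum => b _; apply: rank_spanM.
Qed.

End Span.

(* The quotient by [Q] has finite rank over the polynomial ring in the variables [I]:
   it is spanned, up to denominators, by the bounded monomials in the other variables. *)
Lemma finite_rank : exists (T : finType) (e : T -> R),
  (exists b, e b = 1) /\ forall g, rank_span e g.
Proof.
have [D rel] := uniform_relation.
pose e (b : {ffun 'I_d -> 'I_D.+1}) : R := \prod_(j | j \notin I) 'X_j ^+ b j.
have eE j (b : {ffun 'I_d -> 'I_D.+1}) : j \notin I ->
    e b = 'X_j ^+ b j * \prod_(i | (i \notin I) && (i != j)) 'X_i ^+ b i.
  by move=> Ij; rewrite /e (bigD1 j).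
pose upd (b : {ffun 'I_d -> 'I_D.+1}) j a : {ffun 'I_d -> 'I_D.+1} :=
  [ffun i => if i == j then a else b i].
have updE j b a : j \notin I ->
    e (upd b j a) = 'X_j ^+ a * \prod_(i | (i \notin I) && (i != j)) 'X_i ^+ b i.
  move=> Ij; rewrite (eE j) // ffunE eqxx; congr (_ * _).
  by apply: eq_bigr => i /andP[_ /negbTE ne_ij]; rewrite ffunE ne_ij.
have eb0 : e [ffun => ord0] = 1.
  by rewrite /e big1 // => j _; rewrite ffunE expr0.
have mulX j g : rank_span e g -> rank_span e ('X_j * g).
  have [Ij|Ij] := boolP (j \in I); first by apply: rank_spanM; exact: in_varsX.
  apply: rank_span_closed => b; have [lt_b|] := ltnP (b j) D.
    have lt_b1 : ((b j).+1 < D.+1)%N by [].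
    suff -> : 'X_j * e b = e (upd b j (Ordinal lt_b1)) by exact: rank_spanE.
    by rewrite updE // (eE j) // mulrA -exprS.
  (* At the largest exponent the relation of degree D + 1 for X_j rewrites its top power, times the
     leading coefficient, in terms of lower powers. *)
  move=> le_D; have bjE : b j = D :> nat.
    by apply/eqP; rewrite eqn_leq le_D -ltnS ltn_ord.
  have [p [Ip szp Qp]] := rel j Ij.
  have lead0 : p`_D.+1 != 0.
    by have := lead_coef_eq0 p; rewrite lead_coefE szp /= -size_poly_eq0 szp => /negbT.
  apply: (rank_span_scaled (Ip D.+1) lead0).
  apply: (rank_span_congr (g := \sum_(a < D.+1) - p`_a * e (upd b j a))); last first.
    by apply: rank_span_sum => a _; apply: rank_spanM (rank_spanE _ _);
       rewrite -mulN1r; apply: in_varsM => //; rewrite -mpolyC1 -mpolyCN; apply: in_varsC.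
  have [rest [ebE eupdE]] : exists rest,
      e b = 'X_j ^+ b j * rest /\ forall a, e (upd b j a) = 'X_j ^+ a * rest.
    by eexists; split; [exact: eE|move=> a; exact: updE].
  have := primeN Qprime (primeMr Qprime rest Qp); congr Q.
  rewrite horner_coef szp big_ord_recr /= mulrDr opprD; congr (_ + _).
    rewrite mulr_sumr -sumrN; apply: eq_bigr => a _; rewrite eupdE.
    by ring.
  by rewrite ebE bjE exprS; ring.
exists {ffun 'I_d -> 'I_D.+1}, e; split; first by exists [ffun => ord0].
move=> g; rewrite -[g]mulr1 -eb0; move: (rank_spanE e [ffun => ord0]).
move: (e _); elim/mpoly_gen_ind: g => [c|j|p q IHp IHq|p q IHp IHq] h Sh.
- by apply: rank_spanM => //; exact: in_varsC.
- exact: mulX.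
- by rewrite mulrDl; apply: rank_spanD; [exact: IHp|exact: IHq].
- by rewrite -mulrA; apply: IHp; apply: IHq.
Qed.

(** The determinant trick. With [D] a common denominator, multiplication by [D * g] acts modulo Q on
    the spanning family through a matrix [M] with entries in the variables I. The determinant of
    [D * g - M] sends the family into Q, and the family contains 1. *)
Lemma algebraic_relation g : exists delta (p : {poly R}),
  [/\ in_vars I delta, delta != 0, forall a, in_vars I p`_a, p != 0 & Q p.[delta * g]].
Proof.
have [T [e [[b0 eb0] spanT]]] := finite_rank.
have [delta deltaP] := boolp.choice (fun b => spanT (g * e b)).
have [c cP] := boolp.choice deltaP.
pose D := \prod_b delta b.
pose M := \matrix_(u < #|T|, v < #|T|)
  ((\prod_(b | b != enum_val u) delta b) * c (enum_val u) (enum_val v)).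
have ID : in_vars I D by apply: in_vars_prod => b _; case: (cP b).
exists D, (char_poly M); split=> //.
- by apply/prodf_neq0 => b _; case: (cP b).
- move=> a; apply: in_vars_char_poly => u v; rewrite mxE; apply: in_varsM.
    by apply: in_vars_prod => b _; case: (cP b).
  by case: (cP (enum_val u)).
- exact: monic_neq0 (char_poly_monic M).
pose A := (D * g)%:M - M.
have -> : (char_poly M).[D * g] = \det A.
  rewrite -[LHS]/(horner_eval (D * g) (char_poly M)) /char_poly -det_map_mx.
  congr (\det _); apply/matrixP => u v; rewrite !mxE /= /horner_eval.
  by rewrite hornerD hornerN hornerC hornerMn hornerX.
pose E := \col_(u < #|T|) e (enum_val u).
have AE u : (A *m E) u 0 =
    \prod_(b | b != enum_val u) delta b *
    (delta (enum_val u) * (g * e (enum_val u)) - \sum_b c (enum_val u) b * e b).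
  rewrite mulmxBl mul_scalar_mx !mxE mulrBr /D (bigD1 (enum_val u)) //=.
  congr (_ - _); first by ring.
  rewrite mulr_sumr [RHS](reindex _ (onW_bij _ (@enum_val_bij T))) /=.
  by apply: eq_bigr => v _; rewrite !mxE mulrA.
have QAE u : Q ((A *m E) u 0).
  by rewrite AE; apply: primeMr => //; case: (cP (enum_val u)).
have : Q ((\adj A *m (A *m E)) (enum_rank b0) 0).
  by rewrite mxE; apply: prime_sum => // v _; apply: primeMr.
by rewrite mulmxA mul_adj_mx mul_scalar_mx !mxE enum_rankK eb0 mulr1.
Qed.

End FiniteRank.

Section DimensionDecreases.
Variables (k : fieldType) (d : nat).
Notation R := {mpoly k[d]}.

(* If the dimensions were equal, [x] would be algebraic modulo [Q] over the variables of a
   basis of [P]; the constant term of a minimal relation lies in [P]. *)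
Lemma dim_mod_lt (Q P : R -> Prop) x : prime_ideal Q -> prime_ideal P ->
  subI Q P -> P x -> ~ Q x -> (dim_mod P < dim_mod Q)%N.
Proof.
move=> Qprime Pprime QP Px nQx.
have [I PI cardI] := dim_mod_basis Pprime.
have QI := independent_mod_sub QP PI.
rewrite -cardI ltn_neqAle leq_dim_mod // andbT; apply/negP => /eqP QE.
have [delta [p [Id d0 Ip p0 Qp]]] := algebraic_relation Qprime QE x.
set y := delta * x in Qp.
have Py : P y by apply: primeMr.
have nQy : ~ Q y.
  by have [_ _ QM] := Qprime => /QM[/(QI _ Id)/eqP|//]; rewrite (negbTE d0).
elim/poly_ind: p Ip p0 Qp => [|p c IH] Ip p0 Qp; first by rewrite eqxx in p0.
have c0 : c = 0.
  have Ic : in_vars I c by have := Ip 0%N; rewrite coefD coefMX coefC eqxx add0r.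
  apply: (PI _ Ic); have := primeB Pprime (QP _ Qp) (primeMr Pprime p.[y] Py).
  by congr P; rewrite hornerD hornerMX hornerC addrAC subrr add0r.
rewrite c0 polyC0 addr0 in Ip p0 Qp.
apply: IH.
- by move=> a; have := Ip a.+1; rewrite coefMX.
- by apply: contraNneq p0 => ->; rewrite mul0r.
- by move: Qp; rewrite hornerMX; have [_ _ QM] := Qprime => /QM[].
Qed.

(** The dimension starts at most at d and drops at every step of a chain. Only this inequality
    between height and dimension is needed for the count of local generators. *)
Lemma height_ge_dim_mod (P : R -> Prop) h :
  height_ge P h -> (h + dim_mod P <= d)%N.
Proof.
move=> [c [[cprime clt] cP]].
have dim_eq : dim_mod P = dim_mod (c h).
  by congr dim_mod; apply: boolp.funext => x; apply: boolp.propext; rewrite cP.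
rewrite dim_eq {P cP dim_eq}; have : (h <= h)%N by [].
elim: {1 3 4}h => [|i IH] le_i; first by rewrite add0n dim_mod_le.
have [ci [x [cx ncx]]] := clt i le_i.
have := dim_mod_lt (cprime i (ltnW le_i)) (cprime i.+1 le_i) ci cx ncx.
by have := IH (ltnW le_i); lia.
Qed.

End DimensionDecreases.

(** * Local generators *)

Lemma ideal_of_family (R : comNzRingType) (T : finType) (g : T -> R) x :
  ideal_of (fun y => exists i, y = g i) x -> exists c : T -> R, x = \sum_i c i * g i.
Proof.
move=> [N [h [c [hg ->]]]]; have [idx idxE] := boolp.choice hg.
exists (fun i => \sum_(j < N | idx j == i) c j).
rewrite (partition_big idx predT) //=; apply: eq_bigr => i _.
by rewrite mulr_suml; apply: eq_bigr => j /eqP <-; rewrite idxE.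
Qed.

Lemma ideal_of_sum (R : comNzRingType) (A : R -> Prop) N (g c : 'I_N -> R) :
  (forall i, A (g i)) -> ideal_of A (\sum_(i < N) c i * g i).
Proof. by move=> Ag; exists N, g, c. Qed.

Lemma ideal_ofM (R : comNzRingType) (A : R -> Prop) a x :
  ideal_of A x -> ideal_of A (a * x).
Proof.
move=> [N [g [c [Ag ->]]]]; rewrite mulr_sumr.
by under eq_bigr do rewrite mulrA; apply: (ideal_of_sum (fun i => a * c i)).
Qed.

Lemma ideal_of_gen (R : comNzRingType) (A : R -> Prop) x : A x -> ideal_of A x.
Proof.
move=> Ax; have := @ideal_of_sum R A 1 (fun=> x) (fun=> 1) (fun=> Ax).
by rewrite big_ord1 mul1r.
Qed.

Lemma ideal_ofD (R : comNzRingType) (A : R -> Prop) x y :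
  ideal_of A x -> ideal_of A y -> ideal_of A (x + y).
Proof.
move=> [N [g [c [Ag ->]]]] [M [h [e [Ah ->]]]]; exists (N + M)%N.
exists (fun i => match split i with inl j => g j | inr j => h j end).
exists (fun i => match split i with inl j => c j | inr j => e j end).
split; first by move=> i; case: split.
rewrite big_split_ord /=; congr (_ + _); apply: eq_bigr => i _.
  by case: splitP => j /= ij; [congr (c _ * g _); apply: val_inj|have := ltn_ord i; lia].
by case: splitP => j /= ij; [have := ltn_ord j; lia|congr (e _ * h _); apply: val_inj => /=; lia].
Qed.

Lemma ideal_of0 (R : comNzRingType) (A : R -> Prop) : ideal_of A 0.
Proof. by exists 0%N, (fun=> 0), (fun=> 0); split; [case|rewrite big_ord0]. Qed.

Lemma ideal_of_is_ideal (R : comNzRingType) (A : R -> Prop) : is_ideal (ideal_of A).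
Proof. by split; [exact: ideal_of0|exact: ideal_ofD|exact: ideal_ofM]. Qed.

Section LocalGenerators.
Variables (R : idomainType) (Q : R -> Prop).
Hypothesis Qprime : prime_ideal Q.

(** Over the field of fractions the product factors through a space of dimension h, so its rank is
    less than s. *)
Lemma det_mul_narrow s h (C : 'M[R]_(s, h)) (W : 'M[R]_(h, s)) :
  (h < s)%N -> \det (C *m W) = 0.
Proof.
move=> lt_hs; apply/eqP; rewrite -tofrac_eq0 -det_map_mx /= map_mxM.
apply: contraTT lt_hs => det0; rewrite -leqNgt.
have /mxrank_unit <- : map_mx (@tofrac R) C *m map_mx (@tofrac R) W \in unitmx.
  by rewrite unitmxE unitfE.
exact: mulmx_max_rank.
Qed.

Lemma det_congr s (A B : 'M[R]_s) : (forall i j, Q (A i j - B i j)) -> Q (\det A - \det B).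
Proof.
move=> AB; rewrite /determinant -sumrB; apply: prime_sum => // p _.
rewrite -mulrBr; apply: primeMr => //.
elim/big_rec2: _ => [|i a b _ Qab]; first by rewrite subrr; exact: prime0.
have mix x y : Q (x - y) -> Q (x * b - y * a).
  move=> Qxy; have -> : x * b - y * a = (x - y) * b + y * (b - a) by ring.
  by apply: primeD => //; [apply: primeMl|apply: primeMr].
by apply: mix; apply: AB.
Qed.

Lemma not_prime_prod (T : finType) (A : pred T) (u : T -> R) :
  (forall a, A a -> ~ Q (u a)) -> ~ Q (\prod_(a | A a) u a).
Proof.
have [U1 UM] := prime_mul_closed Qprime => nQ.
by apply: (big_ind (fun x => ~ Q x)).
Qed.

(* If all the entries of [(uv)I - CW] were in [Q], its determinant would show
   [(uv)^s] to be congruent to [\det (CW) = 0]. *)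
Lemma redundant_local_generator s h (beta : 'I_s -> R) (g : 'I_h -> R) : (h < s)%N ->
  (forall a, exists u (c : 'I_h -> R), ~ Q u /\ u * beta a = \sum_b c b * g b) ->
  (forall b, exists v (w : 'I_s -> R), ~ Q v /\ v * g b = \sum_e w e * beta e) ->
  exists a delta (c : 'I_s -> R),
    ~ Q delta /\ delta * beta a = \sum_(e | e != a) c e * beta e.
Proof.
move=> lt_hs /boolp.choice[u /boolp.choice[c cP]] /boolp.choice[v /boolp.choice[w wP]].
have [_ UM] := prime_mul_closed Qprime.
pose u' := \prod_a u a; pose v' := \prod_b v b.
have nu : ~ Q u' by apply: not_prime_prod => a _; case: (cP a).
have nv : ~ Q v' by apply: not_prime_prod => b _; case: (wP b).
pose C := \matrix_(a < s, b < h) ((\prod_(x | x != a) u x) * c a b).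
pose W := \matrix_(b < h, e < s) ((\prod_(x | x != b) v x) * w b e).
have relM a : u' * v' * beta a = \sum_e (C *m W) a e * beta e.
  have -> : u' * v' * beta a = \sum_b C a b * (v' * g b).
    rewrite /u' (bigD1 a) //=; set P := \prod_(x | _) _.
    transitivity (P * v' * (u a * beta a)); first by ring.
    rewrite (cP a).2 mulr_sumr; apply: eq_bigr => b _.
    by rewrite mxE -/P; ring.
  have relW b : v' * g b = \sum_e W b e * beta e.
    rewrite /v' (bigD1 b) //= mulrAC mulrC (wP b).2 mulr_sumr.
    by apply: eq_bigr => e _; rewrite mxE mulrA.
  under eq_bigr do rewrite relW.
  under [RHS]eq_bigr do rewrite mxE mulr_suml.
  rewrite exchange_big /=; apply: eq_bigr => b _; rewrite mulr_sumr.
  by apply: eq_bigr => e _; rewrite mulrA.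
pose M := (u' * v')%:M - C *m W.
have [[a [e nQae]]|allQ] := boolp.pselect (exists a e, ~ Q (M a e)).
  exists e, (M a e), (fun x => - M a x); split=> //.
  have : \sum_x M a x * beta x = 0.
    rewrite (eq_bigr (fun x =>
      (u' * v')%:M a x * beta x - (C *m W) a x * beta x)) => [|x _]; last first.
      by rewrite [M a x]mxE [X in _ + X]mxE mulrBl.
    rewrite sumrB -relM (bigD1 a) //= big1 => [|x ne_xa].
      by rewrite mxE eqxx addr0 subrr.
    by rewrite mxE eq_sym (negbTE ne_xa) mul0r.
  rewrite (bigD1 e) //= => /eqP; rewrite addr_eq0 => /eqP ->.
  by rewrite -sumrN; apply: eq_bigr => x _; rewrite mulNr.
exfalso.
have : Q (\det ((u' * v')%:M : 'M_s) - \det (C *m W)).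
  apply: det_congr => a e; apply: boolp.contrapT => nQ; apply: allQ; exists a, e.
  by rewrite /M mxE [X in _ + X]mxE.
rewrite det_mul_narrow // subr0 det_scalar => /(primeX Qprime).
exact: UM.
Qed.

(** The h local generators supplied by [mu_loc_le] are arbitrary elements of the ideal, whereas
    pivots in the T_j require generators among the [alpha]. Starting from all of them, a redundant
    one is dropped as long as more than h remain. *)
Lemma local_generating_subset m (alpha : 'I_m -> R) h :
  mu_loc_le (ideal_of (fun x => exists i, x = alpha i)) Q h ->
  exists J : {set 'I_m}, (#|J| <= h)%N /\ forall a, exists delta (c : 'I_m -> R),
    ~ Q delta /\ delta * alpha a = \sum_(e in J) c e * alpha e.
Proof.
move=> [g [gI alphag]].
pose spans (J : {set 'I_m}) := forall a, exists delta (c : 'I_m -> R),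
  ~ Q delta /\ delta * alpha a = \sum_(e in J) c e * alpha e.
have [nQ1 UM] := prime_mul_closed Qprime.
suff main n (J : {set 'I_m}) : (#|J| <= n)%N -> spans J ->
    exists J' : {set 'I_m}, (#|J'| <= h)%N /\ spans J'.
  apply: (main _ setT (leqnn _)) => a; exists 1, (fun e => (e == a)%:R); split=> //.
  rewrite mul1r (bigD1 a) ?inE //= eqxx mul1r big1 ?addr0 // => e /andP[_ /negbTE ->].
  by rewrite mul0r.
elim: n J => [|n IH] J le_J spJ; first by exists J; split=> //; rewrite (leq_trans le_J).
have [le_Jh|lt_hJ] := leqP #|J| h; first by exists J.
have [delta /boolp.choice[c cP]] := boolp.choice spJ.
pose D := \prod_a delta a.
have nD : ~ Q D by apply: not_prime_prod => a _; case: (cP a).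
have [||a [eps [w [neps wE]]]] :=
    redundant_local_generator (beta := fun u : 'I_#|J| => alpha (enum_val u)) (g := g) lt_hJ.
- move=> a; have [|u [nu uE]] := alphag (alpha (enum_val a)).
    by apply: ideal_of_gen; exists (enum_val a).
  by have [e eE] := ideal_of_family uE; exists u, e.
- move=> b; have [e gE] := ideal_of_family (gI b).
  exists D, (fun x => \sum_i e i * (\prod_(j | j != i) delta j) * c i (enum_val x)).
  split=> //; under [RHS]eq_bigr do rewrite mulr_suml.
  rewrite gE mulr_sumr exchange_big /=; apply: eq_bigr => i _.
  rewrite /D (bigD1 i) //=; set P := \prod_(j | _) _.
  transitivity (e i * P * (delta i * alpha i)); first by ring.
  rewrite (cP i).2 mulr_sumr big_enum_val /=.
  by apply: eq_bigr => x _; rewrite mulrA.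
pose a0 := enum_val a; have a0J : a0 \in J := enum_valP a.
pose w' x := w (enum_rank_in a0J x).
have epsE : eps * alpha a0 = \sum_(e in J :\ a0) w' e * alpha e.
  rewrite wE [RHS](eq_bigl (fun e => (e \in J) && (e != a0))); last first.
    by move=> e; rewrite in_setD1 andbC.
  rewrite [RHS]big_enum_val_cond /=.
  apply: eq_big => [e|e _]; first by rewrite (inj_eq enum_val_inj).
  by rewrite /w' enum_valK_in.
apply: (IH (J :\ a0)); first by move: le_J; rewrite (cardsD1 a0) a0J.
move=> b; exists (eps * delta b), (fun e => c b a0 * w' e + eps * c b e).
split; first by apply: UM => //; case: (cP b).
rewrite -mulrA (cP b).2 (bigD1 a0) //= mulrDr mulrCA epsE mulr_sumr.
rewrite [X in _ + _ * X](eq_bigl (fun e => e \in J :\ a0)); last first.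
  by move=> e; rewrite in_setD1 andbC.
rewrite mulr_sumr -big_split /=; apply: eq_bigr => e _; ring.
Qed.

End LocalGenerators.

(** * Vanishing of Koszul homology *)

Section KoszulVanishing.
Variables (S : idomainType) (l : nat -> S) (r : nat).
Variables (D0 : int -> S -> Prop) (dg : nat -> int) (U : S -> Prop).
Variables (f : nat -> S) (c q : nat) (e0 : int) (Z0 : koszul S r -> Prop).
Notation piece := (koszul_piece D0 dg).
Notation dl := (koszul_d l).
Notation local := (local_span U f).

Hypothesis U_mul : mul_closed U.
Hypothesis U0 : ~ U 0.
Hypothesis D00 : forall e, D0 e 0.
Hypothesis D0B : forall e x y, D0 e x -> D0 e y -> D0 e (x - y).
Hypothesis D0U : forall u e s, U u -> D0 e s -> D0 e (u * s).
Hypothesis D0f : forall i e s, (i < c)%N -> D0 e s -> D0 (e + 1) (f i * s).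
Hypothesis D0l : forall j e s, (j < r)%N -> D0 e s -> D0 (e + dg j) (l j * s).
Hypothesis f_tri : triangular U f c.
Hypothesis f_decomp : forall i e s, (i < c)%N -> D0 (e + 1) s -> local i.+1 s ->
  exists u v, [/\ U u, D0 e v & local i (u * s - f i * v)].
Hypothesis top : forall e (z : koszul S r), (e0 + c%:Z <= e)%R ->
  piece (q + c) e z -> koszul_in (local c) z.
Hypothesis Z0P : forall e (w z : koszul S r), piece 0 e w -> piece 1 (e + 1) z ->
  dl z = f 0%N *: w -> Z0 w.

Definition koszul_cycle p (z : koszul S r) : Prop := if p is 0 then Z0 z else dl z = 0.

Hypothesis torsion : forall p e z, (q <= p)%N -> (e0 <= e)%R ->
  piece p e z -> koszul_cycle p z -> forall j, (j < c)%N ->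
  exists (a : nat) u v, [/\ U u, piece p.+1 (e + a%:Z) v & (u * f j ^+ a) *: z = dl v].

(** The acyclicity lemma for [N i] equal to the vectors with coefficients in [local_span U f i]. For
    i = 0 this is zero, S being a domain and 0 outside U, so congruences modulo [N 0] are
    equalities. *)
Theorem koszul_homology_vanishes e z : (e0 <= e)%R -> piece q e z -> koszul_cycle q z ->
  exists u v, [/\ U u, piece q.+1 e v & u *: z = dl v].
Proof.
pose N i (x : koszul S r) := koszul_in (local i) x.
have idl i := local_span_ideal f U_mul i.
have N0P x : N 0%N x <-> x = 0.
  split=> [Nx|->]; last exact: koszul_in0.
  by apply: koszul_in_eq0; apply: koszul_in_sub Nx; apply: local_span0.
have H := @homology_vanishes S (koszul S r) (koszul_d l (r:=r)) U
  (fun p e => piece p e) N c q e0 f Z0.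
have {}H : torsion_homology (koszul_d l (r:=r)) U (fun p e => piece p e) N c q e0 f Z0 0
    -> vanishing_homology (koszul_d l (r:=r)) U (fun p e => piece p e) N q e0 Z0 0.
  apply: H => //.
  - by move=> p e1; apply: koszul_piece0.
  - by move=> p e1 x y; apply: koszul_pieceB.
  - move=> p e1 u x Uu Dx; rewrite -[e1]addr0; apply: koszul_pieceZ Dx => // e2 s Ds.
    by rewrite addr0; apply: D0U.
  - move=> i p e1 x lt_ic; apply: koszul_pieceZ => // e2 s; exact: D0f lt_ic.
  - by move=> p e1 x; apply: koszul_d_piece => // j e2 y; apply: D0l.
  - by move=> x; apply: koszul_dd.
  - by move=> i; apply: koszul_in0.
  - by move=> i x y; apply: koszul_inB.
  - by move=> i s x; apply: koszul_inZ.
  - by move=> i x; apply: koszul_in_sub => s; apply: local_span_succ.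
  - by move=> i x; apply: koszul_in_of_mem => //; apply: local_span_gen.
  - by move=> i x; apply: koszul_in_d.
  - move=> i p e1 x lt_ic; apply: koszul_in_regular; first by case: (idl i).
    by move=> e2 s _; apply: triangular_regular f_tri lt_ic.
  - move=> i p e1 x lt_ic Dx Nx; apply: (koszul_in_decomp (idl i) U_mul D00 D0U) Dx Nx.
    by move=> e2 s; apply: f_decomp lt_ic.
  - move=> e1 w x Dw Dx /N0P/eqP; rewrite subr_eq0 => /eqP; exact: (Z0P Dw Dx).
have cycleE p x : relative_cycle (koszul_d l (r:=r)) N Z0 0 p x <-> koszul_cycle p x.
  by case: p => [|p] //=; apply: N0P.
have tors0 : torsion_homology (koszul_d l (r:=r)) U (fun p e => piece p e) N c q e0 f Z0 0.
  move=> p e1 x; rewrite addn0 addr0 => le_p le_e Dx /cycleE cx j lt_jc.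
  have [a [u [v [Uu Dv uE]]]] := torsion le_p le_e Dx cx lt_jc.
  by exists a, u, v; split=> //; apply/N0P; rewrite uE subrr.
move=> le_e Dz cz; have := H tors0 e z; rewrite addn0 addr0.
case=> //; first by apply/cycleE.
by move=> u [v [Uu Dv /N0P/eqP]]; rewrite subr_eq0 => /eqP uE; exists u, v.
Qed.

End KoszulVanishing.

(** * Exactness at the primes of the punctured spectrum *)

Section LocalExactness.
Variables (R S : idomainType) (iota : {rmorphism R -> S}) (l : nat -> S) (r : nat).
Variable A : S -> Prop.

Definition lin_span (s : S) : Prop := exists c : nat -> S, s = \sum_(j < r) c j * l j.

Notation K := (koszul S r).
Notation dK := (koszul_d l).
Notation piece := (koszul_piece (fun _ (_ : S) => True) (fun=> 0)).

Lemma lin_span_ideal : is_ideal lin_span.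
Proof.
split.
- by exists (fun=> 0); rewrite big1 // => j _; rewrite mul0r.
- move=> _ _ [c ->] [e ->]; exists (fun j => c j + e j).
  by rewrite -big_split; apply: eq_bigr => j _; rewrite /= mulrDl.
- move=> s _ [c ->]; exists (fun j => s * c j).
  by rewrite mulr_sumr; apply: eq_bigr => j _; rewrite mulrA.
Qed.

Lemma lin_span_gen j : (j < r)%N -> lin_span (l j).
Proof.
move=> lt_j; exists (fun i => (i == j)%:R); rewrite (bigD1 (Ordinal lt_j)) //= eqxx mul1r.
rewrite big1 ?addr0 // => i; rewrite -val_eqE /= => /negbTE ->.
by rewrite mul0r.
Qed.

Lemma piece_any p e e' (z : K) : piece p e z -> piece p e' z.
Proof.
elim: {z}r p e e' (z : koszul S _) => [|n IH] [|p] e e' z //=.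
  by case=> /IH.
by case=> Da Db; split; [apply: IH Da|apply: IH Db].
Qed.

(** With these cycles the homology in degree 0 is the quotient of A by the ideal of the [l j], so
    that exactness at a prime includes the local equality of the two. *)
Definition aug_cycle p (z : K) : Prop :=
  if p is 0 then exists2 F, A F & z = koszul_of_scalar _ F else dK z = 0.

Definition bounds p (s : S) (z : K) : Prop :=
  exists2 w, piece p.+1 0 w & s *: z = dK w.

Lemma boundsD p s t z : bounds p s z -> bounds p t z -> bounds p (s + t) z.
Proof.
move=> [v Dv vE] [w Dw wE]; exists (v + w); first exact: koszul_pieceD.
by rewrite scalerDl vE wE linearD.
Qed.

Lemma boundsM p s t z : bounds p t z -> bounds p (s * t) z.
Proof.
move=> [v Dv vE]; exists (s *: v); last by rewrite -scalerA vE linearZ.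
by rewrite -[0]addr0; apply: koszul_pieceZ Dv.
Qed.

Lemma bounds0 p z : bounds p 0 z.
Proof. by exists 0; [apply: koszul_piece0|rewrite scale0r linear0]. Qed.

Lemma lin_span_bounds p s z : lin_span s -> piece p 0 z -> dK z = 0 -> bounds p s z.
Proof.
move=> [c ->] Dz dz.
apply: (big_ind (fun x => bounds p x z)) => [|x y|j _]; first exact: bounds0.
- exact: boundsD.
- apply: boundsM; exists (koszul_h j z).
    by have := koszul_h_piece (fun _ => I) (fun _ _ _ _ _ => I) (ltn_ord j) Dz; rewrite addr0.
  by have := koszul_homotopy (l) z (ltn_ord j); rewrite dz linear0 addr0.
Qed.

Lemma aug_cycle_d p z : piece p 0 z -> aug_cycle p z -> dK z = 0.
Proof. by case: p => [|p] // _ [F _ ->]; exact: koszul_d_scalar. Qed.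

Definition exact_at (Q : R -> Prop) : Prop := forall p z,
  piece p 0 z -> aug_cycle p z -> exists u, ~ Q u /\ bounds p (iota u) z.

(* The annihilator of the class of [z] lies in no prime of [Q] avoiding [f], so it
   meets the multiplicative set of the [u f^a] with [u] outside [Q]. *)
Lemma torsion_of_smaller_primes (Q : R -> Prop) f p z : prime_ideal Q ->
  (forall Q', prime_ideal Q' -> subI Q' Q -> ~ Q' f -> exact_at Q') ->
  piece p 0 z -> aug_cycle p z ->
  exists u a, ~ Q u /\ bounds p (iota (u * f ^+ a)) z.
Proof.
move=> Qprime ex Dz cz; apply: boolp.contrapT => nex.
pose J x := bounds p (iota x) z.
pose U x := exists u (a : nat), ~ Q u /\ x = u * f ^+ a.
have [nQ1 UM] := prime_mul_closed Qprime.
have Jid : is_ideal J.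
  split=> [|x y Jx Jy|x y Jy]; first by rewrite /J rmorph0; exact: bounds0.
  - by rewrite /J rmorphD; exact: boundsD.
  - by rewrite /J rmorphM; exact: boundsM.
have Umul : mul_closed U.
  split; first by exists 1, 0%N; rewrite expr0 mulr1.
  move=> _ _ [u [a [nu ->]]] [v [b [nv ->]]]; exists (u * v), (a + b)%N.
  by split; [exact: UM|rewrite exprD mulrACA].
have [|Q' [Q'prime JQ' Q'U]] := exists_prime_disjoint Jid Umul.
  by move=> x Jx [u [a [nu xE]]]; apply: nex; exists u, a; rewrite -xE.
have Q'Q : subI Q' Q.
  move=> x Q'x; apply: boolp.contrapT => nQx; apply: (Q'U x Q'x).
  by exists x, 0%N; rewrite expr0 mulr1.
have nQ'f : ~ Q' f by move=> Q'f; apply: (Q'U f Q'f); exists 1, 1%N; rewrite mul1r.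
have [u [nQ'u Ju]] := ex Q' Q'prime Q'Q nQ'f p z Dz cz.
exact: nQ'u (JQ' u Ju).
Qed.

Definition off_prime (Q : R -> Prop) (s : S) : Prop := exists2 u, ~ Q u & s = iota u.

Hypothesis iota_inj : injective iota.
Hypothesis lin_span_A : forall s, lin_span s -> A s.
Hypothesis A_cancel : forall x s, x != 0 -> A (iota x * s) -> A s.

Lemma off_prime_mul_closed Q : prime_ideal Q -> mul_closed (off_prime Q).
Proof.
move=> /prime_mul_closed[nQ1 UM]; split; first by exists 1; rewrite ?rmorph1.
by move=> _ _ [u nu ->] [v nv ->]; exists (u * v); [exact: UM|rewrite rmorphM].
Qed.

Lemma off_prime0 Q : prime_ideal Q -> ~ off_prime Q 0.
Proof.
move=> Qprime [u nu /eqP]; rewrite eq_sym -(rmorph0 iota) (inj_eq iota_inj) => /eqP u0.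
by apply: nu; rewrite u0; exact: prime0.
Qed.

(** Both kinds of terms make the homology torsion: an element of Q by exactness at the smaller
    primes that avoid it, an element of [lin_span] by the Koszul homotopy. The complex is zero in
    degree q + c > r, which settles [top]. For q = 0, an equation [dl z = f 0 *: w] puts [f 0 * w]
    in A, and cancelling the nonzero element [f 0] of R puts w in A. *)
Lemma exact_at_of_sequence (Q : R -> Prop) f c q : prime_ideal Q ->
  (forall x Q', Q x -> prime_ideal Q' -> subI Q' Q -> ~ Q' x -> exact_at Q') ->
  triangular (off_prime Q) f c ->
  (forall i, (i < c)%N -> (exists2 x, f i = iota x & Q x) \/ lin_span (f i)) ->
  (r < q + c)%N ->
  (q = 0%N -> exists2 x, f 0%N = iota x & x != 0) ->
  forall z, piece q 0 z -> aug_cycle q z -> exists u, ~ Q u /\ bounds q (iota u) z.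
Proof.
move=> Qprime ex f_tri f_kind lt_top q_pos z Dz cz.
have Umul := off_prime_mul_closed Qprime.
have U0 := off_prime0 Qprime.
pose Z0 : K -> Prop := if q is 0 then @aug_cycle 0 else fun _ => True.
have cycle_of p (x : K) : (q <= p)%N -> koszul_cycle l Z0 p x -> aug_cycle p x.
  by rewrite /Z0; case: p q {Dz cz lt_top q_pos Z0} => [|p] [|q].
have [u [v [[u' nu ->] Dv uE]]] : exists u v,
    [/\ off_prime Q u, piece q.+1 0 v & u *: z = dK v].
  apply: (koszul_homology_vanishes (e0 := 0) (Z0 := Z0) Umul U0 _ _ _ _ _ f_tri) => //.
  - move=> i e s lt_i _ /(local_span_decomp Umul)[u [v [Uu uv]]].
    by exists u, v.
  - move=> e x _ Dx; rewrite (koszul_piece_gt lt_top Dx).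
    exact: (koszul_in0 (local_span_ideal f Umul _)).
  - move=> e w x Dw Dx dx; rewrite /Z0; case: (q) q_pos => // /(_ erefl)[y f0E y0].
    have [F _ wE] := koszul_piece0_scalar Dw.
    have [c' cE] := koszul_d1 l Dx.
    exists F => //; apply: (A_cancel y0); apply: lin_span_A.
    exists c'; apply: (@koszul_of_scalar_inj _ r).
    by rewrite -cE dx f0E wE koszul_of_scalarZ.
  - move=> p e x le_p _ Dx cx j lt_j; have {}cx := cycle_of p x le_p cx.
    have {}Dx := piece_any 0 Dx.
    have [[y fE Qy]|Lf] := f_kind j lt_j.
      have [|u [a [nu [w Dw wE]]]] := @torsion_of_smaller_primes Q y p x Qprime _ Dx cx.
        by move=> Q'; apply: ex.
      exists a, (iota u), w; split; [by exists u|exact: piece_any Dw|].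
      by rewrite fE -wE rmorphM rmorphXn.
    have [w Dw wE] := lin_span_bounds Lf Dx (aug_cycle_d Dx cx).
    exists 1%N, 1, w; split; [by have [] := Umul|exact: piece_any Dw|].
    by rewrite expr1 mul1r.
  - by rewrite /Z0; case: (q) cz.
by exists u'; split=> //; exists v.
Qed.

Variable dim : (R -> Prop) -> nat.
Hypothesis dim_lt : forall Q P x, prime_ideal Q -> prime_ideal P -> subI Q P -> P x ->
  ~ Q x -> (dim P < dim Q)%N.
Variable d : nat.
Hypothesis dim_le : forall Q, (dim Q <= d)%N.

Hypothesis sequence : forall Q, prime_ideal Q -> (0 < dim Q)%N -> exists f c,
  [/\ triangular (off_prime Q) f c,
    forall i, (i < c)%N -> (exists2 x, f i = iota x & Q x) \/ lin_span (f i),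
    (r <= c)%N &
    (forall F, A F -> exists2 u, ~ Q u & lin_span (iota u * F)) \/
    ((r < c)%N /\ exists2 x, f 0%N = iota x & x != 0)].

(** Induction on d - dim Q, since smaller primes have larger dimension. In degree p + 1 a sequence
    of r terms is long enough; degree 0 needs one more term, or a direct proof that A agrees with
    [lin_span] at Q. *)
Theorem exact_at_prime Q : prime_ideal Q -> (0 < dim Q)%N -> exact_at Q.
Proof.
have [n] := ubnP (d - dim Q)%N; elim: n Q => // n IH Q lt_n Qprime dimQ.
have ex x Q' : Q x -> prime_ideal Q' -> subI Q' Q -> ~ Q' x -> exact_at Q'.
  move=> Qx Q'prime Q'Q nQ'x.
  have lt_dim := dim_lt Q'prime Qprime Q'Q Qx nQ'x.
  by apply: IH => //; have := dim_le Q'; lia.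
have [f [c [f_tri f_kind le_c alt]]] := sequence Qprime dimQ.
case=> [|p] z Dz cz; last first.
  by apply: (exact_at_of_sequence (f := f) (c := c)) => //; rewrite addSn ltnS; lia.
case: alt => [direct|[lt_c f0]]; last exact: (exact_at_of_sequence (f := f) (c := c)).
have [F AF zE] := cz; have [u nu Lu] := direct F AF.
exists u; split=> //.
have [||w Dw wE] := lin_span_bounds (p := 0) (z := koszul_of_scalar r 1) Lu.
- exact: koszul_piece_scalar.
- exact: koszul_d_scalar.
by exists w => //; rewrite -wE zE -!koszul_of_scalarZ mulr1.
Qed.

End LocalExactness.

(** * The graded argument at the irrelevant ideal *)

Section GradedRing.
Variables (S : comNzRingType) (tau : {rmorphism S -> {poly S}}).

(** A grading by natural numbers, given as the ring map sending s to the sum of its components s_e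
    times X^e. *)
Definition is_grading : Prop :=
  (forall s, (tau s).[1] = s) /\
  (forall s e, tau (tau s)`_e = ((tau s)`_e)%:P * 'X^e).

(** Degrees are integers because [koszul_piece] subtracts the degrees of the generators; in negative
    degrees there is only 0. *)
Definition of_degree (e : int) (s : S) : Prop :=
  if e is Posz n then tau s = s%:P * 'X^n else s = 0.

Definition component (e : int) (s : S) : S := if e is Posz n then (tau s)`_n else 0.

Hypothesis tauP : is_grading.

Lemma of_degree0 e : of_degree e 0.
Proof. by case: e => n //=; rewrite rmorph0 polyC0 mul0r. Qed.

Lemma of_degreeB e s t : of_degree e s -> of_degree e t -> of_degree e (s - t).
Proof.
case: e => n /= sE tE; first by rewrite rmorphB /= sE tE polyCB mulrBl.
by rewrite sE tE subr0.
Qed.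

Lemma of_degreeM (e : int) (n : nat) s t :
  tau s = s%:P * 'X^n -> of_degree e t -> of_degree (e + n%:Z) (s * t).
Proof.
move=> sE; case: e => a tE; last by rewrite tE mulr0; exact: of_degree0.
rewrite -PoszD; rewrite /= in tE *; rewrite rmorphM /= sE tE polyCM exprD.
by rewrite mulrACA ['X^n * _]mulrC.
Qed.

Lemma of_degree_component e s : of_degree e (component e s).
Proof. by case: e => n //=; case: tauP. Qed.

Lemma component_of_degree e s : of_degree e s -> component e s = s.
Proof. by case: e => n /= -> //; rewrite coefMXn ltnn subnn coefC. Qed.

Lemma component_is_additive e : additive (component e).
Proof. by move=> s t; case: e => n /=; rewrite ?subr0 // rmorphB coefB. Qed.

HB.instance Definition _ e :=
  GRing.isAdditive.Build S S (component e) (component_is_additive e).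

Lemma componentM (e : int) (n : nat) s t :
  tau s = s%:P * 'X^n -> component (e + n%:Z) (s * t) = s * component e t.
Proof.
move=> sE; case: e => a.
  rewrite -PoszD /= rmorphM /= sE -mulrA coefCM coefXnM.
  by rewrite ltnNge leq_addl /= addnK.
rewrite /= mulr0; case eE: (Negz a + n%:Z) => [b|b] //=.
rewrite rmorphM /= sE -mulrA coefCM coefXnM ifT ?mulr0 //.
by move: eE; lia.
Qed.

Lemma component_scale e s t : of_degree e t -> component e (s * t) = (tau s)`_0 * t.
Proof.
case: e => n /= tE; last by rewrite tE mulr0.
by rewrite rmorphM /= tE mulrA coefMXn ltnn subnn coefMC.
Qed.

Lemma sum_components s : s = \sum_(e < size (tau s)) (tau s)`_e.
Proof.
have [ev _] := tauP; rewrite -{1}(ev s) horner_coef.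
by apply: eq_bigr => e _; rewrite expr1n mulr1.
Qed.

Section KoszulComponents.
Variables (l : nat -> S) (dg : nat -> nat).
Notation dgz := (fun j => (dg j)%:Z).

Fixpoint koszul_component r (e : int) : koszul S r -> koszul S r :=
  if r is r'.+1 return koszul S r -> koszul S r
  then fun z => (koszul_component e z.1, koszul_component (e - (dg r')%:Z) z.2)
  else component e.

Lemma koszul_componentD r e (x y : koszul S r) :
  koszul_component e (x + y) = koszul_component e x + koszul_component e y.
Proof.
by elim: r e x y => [|r IH] e x y /=; [exact: raddfD|rewrite !IH].
Qed.

Lemma koszul_component0 r e : koszul_component e (0 : koszul S r) = 0.
Proof. by elim: r e => [|r IH] e /=; [exact: raddf0|rewrite !IH]. Qed.

Lemma koszul_componentN r e (x : koszul S r) :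
  koszul_component e (- x) = - koszul_component e x.
Proof.
by apply/eqP; rewrite -addr_eq0 -koszul_componentD addNr koszul_component0.
Qed.

Lemma koszul_componentZ r (e : int) (n : nat) s (x : koszul S r) :
  tau s = s%:P * 'X^n ->
  koszul_component (e + n%:Z) (s *: x) = s *: koszul_component e x.
Proof.
move=> sE; elim: r e x => [|r IH] e x /=; first exact: componentM.
by rewrite IH addrAC IH.
Qed.

Lemma koszul_component_d r e (z : koszul S r) :
  (forall j, (j < r)%N -> tau (l j) = (l j)%:P * 'X^(dg j)) ->
  koszul_component e (koszul_d l z) = koszul_d l (koszul_component e z).
Proof.
elim: r e z => [|r IH] e z lE; first exact: raddf0.
have lE' j (lt_jr : (j < r)%N) := lE j (ltnW lt_jr).
rewrite /= koszul_componentD koszul_componentN !IH //; congr (_ + _, _).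
by rewrite -{1}[e](subrK (dg r)%:Z) koszul_componentZ //; apply: lE.
Qed.

Lemma koszul_piece_component r p e e' (z : koszul S r) :
  koszul_piece (fun _ (_ : S) => True) (fun=> 0) p e' z ->
  koszul_piece of_degree dgz p e (koszul_component e z).
Proof.
elim: r p e e' z => [|r IH] [|p] e e' z /=; first by move=> _; exact: of_degree_component.
- by move=> ->; exact: raddf0.
- by case=> Da ->; split; [exact: IH Da|exact: koszul_component0].
- by case=> Da Db; split; [exact: IH Da|exact: IH Db].
Qed.

Lemma koszul_component_scale r p e s (z : koszul S r) :
  koszul_piece of_degree dgz p e z -> koszul_component e (s *: z) = (tau s)`_0 *: z.
Proof.
elim: r p e z => [|r IH] [|p] e z /=; first exact: component_scale.
- by move=> ->; rewrite !scaler0 raddf0.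
- case=> Da z2; rewrite (IH _ _ _ Da) z2 scaler0 koszul_component0.
  by apply: injective_projections; rewrite //= z2 scaler0.
- by case=> Da Db; rewrite (IH _ _ _ Da) (IH _ _ _ Db).
Qed.

Lemma koszul_piece_forget r p e e' (z : koszul S r) : koszul_piece of_degree dgz p e z ->
  koszul_piece (fun _ (_ : S) => True) (fun=> 0) p e' z.
Proof.
elim: r p e e' z => [|r IH] [|p] e e' z //=; case=> Da Db; split=> //; first exact: IH Da.
  exact: IH Da.
exact: IH Db.
Qed.

(** When all the [l j] are linear, the generators in homological degree p have internal degree p, so
    in degree e > p every coefficient has positive degree. *)
Lemma koszul_piece_positive J r p e (z : koszul S r) : is_ideal J ->
  (forall e s, (0 < e)%R -> of_degree e s -> J s) -> (forall j, (j < r)%N -> dg j = 1%N) ->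
  (p%:Z < e)%R -> koszul_piece of_degree dgz p e z -> koszul_in J z.
Proof.
move=> Jid Jpos; elim: r p e z => [|r IH] [|p] e z dg1 lt_e /=; first exact: Jpos.
- by move=> ->; case: Jid.
- by case=> Da ->; split; [apply: IH Da => // j ?; apply: dg1; exact: ltnW|exact: koszul_in0].
case=> Da Db; split; first by apply: IH Da => // j ?; apply: dg1; exact: ltnW.
apply: IH Db => [j ?|]; first by apply: dg1; exact: ltnW.
by rewrite dg1 //; lia.
Qed.

End KoszulComponents.
End GradedRing.

Section GradedVanishing.
Variables (R S : idomainType) (iota : {rmorphism R -> S}) (l : nat -> S) (r : nat).
Variables (A : S -> Prop) (P : R -> Prop) (tau : {rmorphism S -> {poly S}}).
Variables (d n : nat) (x : nat -> R) (dg : nat -> nat).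
Notation L := (lin_span l r.+1).
Notation dgz := (fun j => (dg j)%:Z).

Hypothesis lin_span_A : forall s, L s -> A s.
Hypothesis A_cancel : forall y s, y != 0 -> A (iota y * s) -> A s.
Hypothesis A_prime : prime_ideal A.
Hypothesis A_torsion : forall F, A F -> exists2 u, u != 0 & L (iota u * F).
Hypothesis P_prime : prime_ideal P.
Hypothesis P_exact : forall y Q, P y -> prime_ideal Q -> subI Q P -> ~ Q y ->
  exact_at iota l r.+1 A Q.
Hypothesis tauP : is_grading tau.
Hypothesis d_gt0 : (0 < d)%N.
Hypothesis n_gt0 : (0 < n)%N.
Hypothesis P_x : forall i, (i < d)%N -> P (x i).
Hypothesis x0 : x 0%N != 0.
Hypothesis tau_x : forall i, (i < d)%N -> tau (iota (x i)) = (iota (x i))%:P * 'X.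
Hypothesis tau_l : forall j, (j < r.+1)%N -> tau (l j) = (l j)%:P * 'X^(dg j).
Hypothesis dg1 : forall j, (j < r)%N -> dg j = 1%N.
Hypothesis dgn : dg r = n.
Hypothesis tau_pos : forall s, (tau s)`_0 = 0 ->
  exists c : nat -> S, s = \sum_(i < d) c i * iota (x i).
Hypothesis tau_unit : forall u, ~ P u ->
  exists2 v, tau v = v%:P & v * (tau (iota u))`_0 = 1.
Hypothesis x_tri : triangular (fun s => s = 1) (fun i => iota (x i)) d.

Notation f := (fun i => iota (x i)).
Notation U1 := (fun s : S => s = 1).

Let U1_mul : mul_closed U1.
Proof. by split=> // a b -> ->; rewrite mulr1. Qed.

Let positive_span e s : (0 < e)%R -> of_degree tau e s -> local_span U1 f d s.
Proof.
case: e => [[|a]|a] //= _ sE; have [|c sc] := tau_pos (s := s).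
  by rewrite sE coefMXn.
by exists 1, c; rewrite mul1r.
Qed.

Let tau_x1 i : (i < d)%N -> tau (f i) = (f i)%:P * 'X^1.
Proof. by move=> lt_i; rewrite tau_x. Qed.

Theorem of_degree_rees_lin_span (e : int) F : (n%:Z <= e)%R ->
  of_degree tau e F -> A F -> L F.
Proof.
move=> le_e Fe AF.
pose Z0 : koszul S r.+1 -> Prop := aug_cycle l A 0.
suff [u [v [-> Dv]]] : exists u v, [/\ U1 u, koszul_piece (of_degree tau) dgz 1 e v
    & u *: koszul_of_scalar r.+1 F = koszul_d l v].
  have [c ->] := koszul_d1 l Dv; rewrite scale1r => /koszul_of_scalar_inj FE.
  by exists c.
apply: (koszul_homology_vanishes (f := f) (c := d) (e0 := n%:Z) (Z0 := Z0) (q := 0)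
  U1_mul) => //.
- by move/eqP; rewrite eq_sym oner_eq0.
- exact: of_degree0.
- exact: of_degreeB.
- by move=> u e1 s ->; rewrite mul1r.
- by move=> i e1 s lt_i; apply: of_degreeM; exact: tau_x1.
- by move=> j e1 s lt_j; apply: of_degreeM; exact: tau_l.
(* Since s and the terms f j are homogeneous, each coefficient of the relation may be replaced by
   its component of degree e1. *)
- move=> i e1 s lt_i sE [u [c [-> cE]]]; exists 1, (component tau e1 (c i)).
  split=> //; first exact: of_degree_component.
  exists 1, (fun j => component tau e1 (c j)); split=> //.
  rewrite !mul1r in cE *; rewrite -{1}(component_of_degree sE) cE raddf_sum big_ord_recr /=.
  have fE j : (j < d)%N -> component tau (e1 + 1) (c j * f j) = component tau e1 (c j) * f j.
    by move=> lt_j; rewrite mulrC (componentM _ _ (tau_x1 lt_j)) mulrC.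
  rewrite fE // [f i * _]mulrC addrK; apply: eq_bigr => j _; apply: fE.
  exact: ltn_trans (ltn_ord j) lt_i.
(* The generators of K_d involving only linear equations have degree d, the others d - 1 + n. Both
   are less than n + d, so in degrees from n + d on all coefficients have positive degree and lie in
   (x)S. *)
- move=> e1 z le_e1; have idJ := local_span_ideal f U1_mul d.
  rewrite add0n; case: (d) d_gt0 le_e1 idJ positive_span => // d' _ le_e1 idJ pos.
  case=> Da Db; split.
    by apply: koszul_piece_positive idJ pos dg1 _ Da; lia.
  by apply: koszul_piece_positive idJ pos dg1 _ Db; rewrite dgn; lia.
- move=> e1 w z Dw Dz dz; have [G _ wE] := koszul_piece0_scalar Dw.
  have [c cE] := koszul_d1 l Dz.
  exists G => //; apply: (A_cancel x0); apply: lin_span_A; exists c.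
  by apply: (@koszul_of_scalar_inj _ r.+1); rewrite -cE dz wE koszul_of_scalarZ.
- move=> p e1 z _ _ Dz cz j lt_j.
  have {}cz : aug_cycle l A p z by case: p cz {Dz}.
  have D'z := koszul_piece_forget 0 Dz.
  have [|u [a [nu [w Dw wE]]]] := @torsion_of_smaller_primes _ _ iota l _ A P (x j) p z
      P_prime _ D'z cz.
    by move=> Q; apply: P_exact; exact: P_x.
  (* In the component of degree e1 + a only the constant part of u survives, because z and the power
     of x j are homogeneous. This part is invertible with inverse v, so the denominator u outside P
     disappears and U = {1} suffices. *)
  have [v tau_v vE] := tau_unit nu.
  have tau_xa : tau (f j ^+ a) = (f j ^+ a)%:P * 'X^a.
    by rewrite rmorphXn /= tau_x // exprMn rmorphXn.
  exists a, 1, (v *: koszul_component tau dg (e1 + a%:Z) w); split=> //.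
    rewrite -[e1 + a%:Z]addr0; apply: koszul_pieceZ.
      by move=> e2 s; apply: of_degreeM; rewrite expr0 mulr1.
    by rewrite addr0; apply: koszul_piece_component Dw.
  have dZ y : koszul_d l (v *: y : koszul S r.+1) = v *: koszul_d l y by exact: linearZ.
  rewrite dZ -koszul_component_d // -wE rmorphM rmorphXn [iota u * _]mulrC.
  rewrite -[(_ * iota u) *: z]scalerA koszul_componentZ // (koszul_component_scale _ Dz).
  by rewrite !scalerA mul1r mulrAC vE mul1r.
- by apply: koszul_piece_scalar.
- by exists F.
Qed.

(* Homogeneity of the prime ideal [A]: compare the lowest components outside [A]. *)
Lemma rees_component F e : A F -> A (tau F)`_e.
Proof.
move=> AF; have [u u0 [c Lu]] := A_torsion AF.
have nAu : ~ A (iota u).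
  move=> Au; have [_ A1 _] := A_prime; apply: A1; apply: (A_cancel u0).
  by rewrite mulr1.
(* The product lies in the ideal generated by the homogeneous elements [l j], all in A, so each of
   its components does. *)
have AuF a : A (tau (iota u * F))`_a.
  rewrite Lu rmorph_sum coef_sum; apply: prime_sum => // j _.
  rewrite rmorphM /= tau_l // mulrA coefMXn coefMC.
  case: ifP => _; first exact: prime0.
  by apply: primeMr => //; apply: lin_span_A; exact: lin_span_gen.
have [i0 nAi0 i0min] : exists2 i0, ~ A (tau (iota u))`_i0 &
    forall i, (i < i0)%N -> A (tau (iota u))`_i.
  have [i nAi] : exists i, ~ A (tau (iota u))`_i.
    apply: boolp.contrapT => nex; apply: nAu; rewrite [iota u](sum_components tauP).
    apply: prime_sum => // i _; apply: boolp.contrapT => nA; apply: nex.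
    by exists i.
  have [n0] := ubnP i; elim: n0 i nAi => // n0 IH i nAi lt_i.
  have [ex|nex] := boolp.pselect (exists2 i', (i' < i)%N & ~ A (tau (iota u))`_i').
    by have [i' lt_i' nAi'] := ex; apply: (IH i') => //; lia.
  exists i => // i' lt_i'; apply: boolp.contrapT => nA; apply: nex.
  by exists i'.
have [n0] := ubnP e; elim: n0 e => // n0 IH e lt_e.
have := AuF (i0 + e)%N; rewrite rmorphM /= coefM.
have lt_i0 : (i0 < (i0 + e).+1)%N by lia.
rewrite (bigD1 (Ordinal lt_i0)) //= addKn => Asum.
have Aie : A ((tau (iota u))`_i0 * (tau F)`_e).
  rewrite -[X in A X](addrK (\sum_(i < (i0 + e).+1 | i != Ordinal lt_i0)
    (tau (iota u))`_i * (tau F)`_(i0 + e - i))).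
  apply: primeB => //; apply: prime_sum => // i ne_i.
  have [lt_ii0|le_i0i] := ltnP i i0; first by apply: primeMl => //; exact: i0min.
  apply: primeMr => //; apply: IH.
  have : (i : nat) != i0 by apply: contraNneq ne_i => ii0; apply/eqP/val_inj.
  by have := ltn_ord i; lia.
by have [_ _ AM] := A_prime; case: (AM _ _ Aie).
Qed.

(** The product has no component of degree less than n, because y has none. Its other components lie
    in A by homogeneity, hence in L by the vanishing in degrees at least n. *)
Theorem rees_mul_lin_span F y : A F -> (forall e, (e < n)%N -> (tau y)`_e = 0) -> L (F * y).
Proof.
move=> AF y0; pose G := F * y.
have AG : A G by apply: primeMl.
have [L0 LD _] := lin_span_ideal l r.+1.
have Lcomp e : L (tau G)`_e.
  have [lt_en|le_ne] := ltnP e n; last first.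
    apply: (of_degree_rees_lin_span (e := e%:Z)) => //; last exact: rees_component.
    by have [_ hom] := tauP; apply: hom.
  suff -> : (tau G)`_e = 0 by [].
  rewrite rmorphM coefM big1 // => i _; rewrite y0 ?mulr0 //.
  by rewrite (leq_ltn_trans (leq_subr _ _)).
rewrite -/G [G](sum_components tauP); apply: big_ind => // e _; exact: Lcomp.
Qed.

End GradedVanishing.

(** * The Rees algebra and its linear equations *)

Section ReesAlgebra.
Variables (R : idomainType) (m : nat).
Notation S := {mpoly R[m]}.
Variables (alpha : 'rV[R]_m) (phi : 'M[R]_(m, m.-1)).
Hypothesis alpha_phi : alpha *m phi = 0.
Hypothesis alpha_ker : forall v : 'cV[R]_m, alpha *m v = 0 -> exists w, v = phi *m w.

Definition sym_ideal : S -> Prop :=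
  ideal_of (fun F => exists j : 'I_m.-1, F = \sum_(i < m) 'X_i * (phi i j)%:MP).

Definition rees_kernel : S -> Prop :=
  fun F => mmap (fun c : R => c%:P) (fun j => (alpha 0 j)%:P * 'X) F = 0.

Definition sym_eq (j : nat) : S :=
  if insub j is Some j' then \sum_(i < m) 'X_i * (phi i j')%:MP else 0.

Lemma sym_eq_ord (j : 'I_m.-1) : sym_eq j = \sum_(i < m) 'X_i * (phi i j)%:MP.
Proof. by rewrite /sym_eq valK. Qed.

Lemma sym_idealP F : sym_ideal F <->
  exists c : nat -> S, F = \sum_(j < m.-1) c j * sym_eq j.
Proof.
split=> [/ideal_of_family[c ->]|[c ->]].
  exists (fun j => if insub j is Some j' then c j' else 0).
  by apply: eq_bigr => j _; rewrite valK sym_eq_ord.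
by apply: (ideal_of_sum (fun j : 'I_m.-1 => c j)) => j; exists j; rewrite sym_eq_ord.
Qed.

Lemma sym_ideal_is_ideal : is_ideal (sym_ideal).
Proof. exact: ideal_of_is_ideal. Qed.

Definition rees_map : S -> {poly R} :=
  mmap (@polyC R) (fun j => (alpha 0 j)%:P * 'X).

HB.instance Definition _ := GRing.RMorphism.on rees_map.

Lemma rees_kernelE F : rees_kernel F = (rees_map F = 0).
Proof. by []. Qed.

Lemma rees_mapC c : rees_map c%:MP = c%:P.
Proof. by rewrite /rees_map mmapC. Qed.

Lemma rees_mapX j : rees_map 'X_j = (alpha 0 j)%:P * 'X.
Proof. by rewrite /rees_map mmapX mmap1U. Qed.

Lemma sym_ideal_sub_rees F : sym_ideal F -> rees_kernel F.
Proof.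
move/sym_idealP => [c ->]; rewrite rees_kernelE rmorph_sum big1 // => j _.
rewrite rmorphM sym_eq_ord rmorph_sum /=.
have := congr1 (fun M : 'rV_ _ => M 0 j) alpha_phi; rewrite !mxE => sum0.
rewrite (eq_bigr (fun i => (alpha 0 i * phi i j)%:P * 'X)) => [|i _]; last first.
  by rewrite rmorphM /= rees_mapX rees_mapC polyCM mulrAC.
by rewrite -mulr_suml -rmorph_sum /= sum0 mul0r mulr0.
Qed.

Lemma rees_cancel x F : x != 0 -> rees_kernel (x%:MP * F) -> rees_kernel F.
Proof.
move=> x0; rewrite !rees_kernelE rmorphM /= rees_mapC => /eqP.
by rewrite mulf_eq0 polyC_eq0 (negbTE x0) => /eqP.
Qed.

Lemma sym_ideal_kernel (v : 'I_m -> R) :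
  \sum_i alpha 0 i * v i = 0 -> sym_ideal (\sum_i (v i)%:MP * 'X_i).
Proof.
move=> v0; have [|w vE] := alpha_ker (v := \col_i v i).
  apply/matrixP => a b; rewrite !ord1 !mxE -[RHS]v0.
  by apply: eq_bigr => i _; rewrite mxE.
apply/sym_idealP; exists (fun j => if insub j is Some j' then (w j' 0)%:MP else 0).
under [RHS]eq_bigr do rewrite valK sym_eq_ord mulr_sumr.
rewrite exchange_big /=; apply: eq_bigr => i _.
have := congr1 (fun M : 'cV_ _ => M i 0) vE; rewrite !mxE => ->.
rewrite rmorph_sum mulr_suml; apply: eq_bigr => j _.
by rewrite rmorphM /=; ring.
Qed.

(** The relation is a syzygy of [alpha], hence a combination of the columns of [phi]. At a prime not
    containing [delta] the resulting form is monic in T_a, up to a unit. *)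
Lemma sym_ideal_relation a (J : {set 'I_m}) delta (c : 'I_m -> R) : a \notin J ->
  delta * alpha 0 a = \sum_(e in J) c e * alpha 0 e ->
  sym_ideal (delta%:MP * 'X_a - \sum_(e in J) (c e)%:MP * 'X_e).
Proof.
move=> aJ rel; pose v i := (i == a)%:R * delta - (i \in J)%:R * c i.
have sumv (V : comNzRingType) (h : {rmorphism R -> V}) (x : 'I_m -> V) :
    \sum_i h (v i) * x i = h delta * x a - \sum_(e in J) h (c e) * x e.
  under eq_bigr do rewrite rmorphB !rmorphM !rmorph_nat mulrBl.
  rewrite sumrB; congr (_ - _).
    rewrite (bigD1 a) //= eqxx mul1r big1 ?addr0 // => i /negbTE ->.
    by rewrite !mul0r.
  rewrite [RHS]big_mkcond; apply: eq_bigr => i _.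
  by case: (i \in J); rewrite ?mul1r ?mul0r.
have := @sym_ideal_kernel v; rewrite (sumv _ (@mpolyC m R)); apply.
have := sumv _ idfun (alpha 0); rewrite /= rel subrr => sum0; rewrite -[RHS]sum0.
by apply: eq_bigr => i _; rewrite mulrC.
Qed.

Lemma sym_ideal_minor a b :
  sym_ideal ((alpha 0 a)%:MP * 'X_b - (alpha 0 b)%:MP * 'X_a).
Proof.
have [->|ne_ab] := eqVneq a b; first by rewrite subrr; apply: ideal_of0.
have := @sym_ideal_relation b [set a] (alpha 0 a) (fun=> alpha 0 b).
rewrite !big_set1 inE eq_sym ne_ab; apply=> //; exact: mulrC.
Qed.

(* Modulo [L], [F (alpha_a T)] and [F (alpha T_a)] agree, and the latter is the image
   of [F] in the Rees algebra. *)
Lemma rees_kernel_power a F : rees_kernel F ->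
  exists D, sym_ideal ((alpha 0 a)%:MP ^+ D * F).
Proof.
move=> rF; have [L0 LD LM] := sym_ideal_is_ideal.
pose x := alpha 0 a.
have subst (h : 'I_m -> S) : exists f : {rmorphism S -> S},
    (forall c, f c%:MP = c%:MP) /\ forall j, f 'X_j = h j.
  exists (mmap (@mpolyC m R) h); split=> [c|j] /=; first by rewrite mmapC.
  by rewrite mmapX mmap1U.
have [scale [scaleC scaleX]] := subst (fun j => x%:MP * 'X_j).
have [eval [evalC evalX]] := subst (fun j => (alpha 0 j)%:MP * 'X_a).
have agree G : sym_ideal (scale G - eval G).
  elim/mpoly_gen_ind: G => [c|j|p q Lp Lq|p q Lp Lq].
  - by rewrite scaleC evalC subrr.
  - by rewrite scaleX evalX; apply: sym_ideal_minor.
  - by rewrite !rmorphD /= opprD addrACA; apply: LD.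
  - rewrite !rmorphM /=; move: (scale p) (eval p) (scale q) (eval q) Lp Lq.
    move=> sp ep sq eq Lp Lq.
    have -> : sp * sq - ep * eq = sq * (sp - ep) + ep * (sq - eq) by ring.
    by apply: LD; apply: LM.
(* [G] homogenizes F with x = alpha_a, D being a bound for the degrees of the monomials. The factors
   [x ^+ (D - mdeg nu)] make [scale G] equal to [x ^+ D * F], and multiply the e-th coefficient of
   [rees_map F] by [x ^+ (D - e)], so [rees_map G] is 0. *)
pose D := msize F.
have [h hE] : exists h : 'X_{1..m} -> R, forall nu, h nu = F@_nu * x ^+ (D - mdeg nu).
  by eexists.
have [G GE] : exists G : S, G = \sum_(nu <- msupp F) h nu *: 'X_[nu] by eexists.
have scaleG : scale G = x%:MP ^+ D * F.
  rewrite GE rmorph_sum [F in RHS]mpolyE mulr_sumr /= !big_seq.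
  apply: eq_bigr => nu nuF; rewrite hE.
  rewrite -!mul_mpolyC rmorphM /= scaleC.
  have le_nu : (mdeg nu <= D)%N.
    by apply: ltnW; apply: msize_mdeg_lt.
  have -> : scale 'X_[nu] = x%:MP ^+ mdeg nu * 'X_[nu].
    rewrite mpolyXE_id rmorph_prod mdegE -prodrXr -big_split /=.
    by apply: eq_bigr => j _; rewrite rmorphXn /= scaleX exprMn.
  rewrite rmorphM rmorphXn /= -{2}(subnK le_nu) exprD.
  have shuffle (u v w t : S) : u * v * (w * t) = v * w * (u * t) by ring.
  exact: shuffle.
have reesG : rees_map G = 0.
  apply/polyP => e; rewrite coef0.
  have reesX nu : rees_map 'X_[nu] = (\prod_j alpha 0 j ^+ nu j)%:P * 'X^(mdeg nu).
    rewrite mpolyXE_id rmorph_prod rmorph_prod mdegE -prodrXr -big_split /=.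
    by apply: eq_bigr => j _; rewrite rmorphXn /= rees_mapX exprMn rmorphXn.
  have reesZ y nu : (rees_map (y *: 'X_[nu]))`_e =
      y * (\prod_j alpha 0 j ^+ nu j * (e == mdeg nu)%:R).
    by rewrite -mul_mpolyC rmorphM /= rees_mapC reesX !coefCM coefXn.
  have reesS (w : 'X_{1..m} -> R) : (rees_map (\sum_(nu <- msupp F) w nu *: 'X_[nu]))`_e =
      \sum_(nu <- msupp F) (rees_map (w nu *: 'X_[nu]))`_e.
    by rewrite (raddf_sum rees_map) coef_sum.
  have FE : \sum_(nu <- msupp F) (rees_map (F@_nu *: 'X_[nu]))`_e = 0.
    by rewrite -reesS -mpolyE; move: rF; rewrite rees_kernelE => ->; rewrite coef0.
  rewrite GE reesS -[RHS](mulr0 (x ^+ (D - e))) -[in RHS]FE mulr_sumr.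
  apply: eq_bigr => nu _; etransitivity; first exact: reesZ.
  rewrite hE.
  etransitivity; last exact: (congr1 ( *%R _) (esym (reesZ F@_nu nu))).
  have [->|_] := eqVneq e (mdeg nu); last by rewrite !mulr0.
  by rewrite [F@_nu * x ^+ _]mulrC -mulrA.
have evalG : eval G = (map_poly (@mpolyC m R) (rees_map G)).['X_a].
  rewrite -[RHS]/((horner_eval 'X_a \o (map_poly (@mpolyC m R) \o rees_map)) G).
  apply: mpoly_rmorph_eq => [c|j] /=; rewrite /horner_eval.
    by rewrite evalC rees_mapC map_polyC hornerC.
  rewrite evalX rees_mapX rmorphM /= map_polyC map_polyX.
  by rewrite hornerM hornerC hornerX.
exists D; rewrite -/x -scaleG; have := agree G.
by rewrite evalG reesG rmorph0 horner0 subr0.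
Qed.

End ReesAlgebra.

(** * Triangular sequences in primes *)

Lemma lead_coef_linear (A : idomainType) (a b : A) :
  a != 0 -> lead_coef (a%:P * 'X - b%:P) = a.
Proof.
move=> a0; rewrite lead_coefDl; first by rewrite lead_coefM lead_coefC lead_coefX mulr1.
by rewrite size_polyN size_mulX ?polyC_eq0 // !size_polyC a0; case: eqP.
Qed.

Section LinearForm.
Variables (A : idomainType) (m : nat) (J : {set 'I_m}) (delta : A) (c : 'I_m -> A).

Definition pivot_form (a : 'I_m) : {mpoly A[m]} :=
  delta%:MP * 'X_a - \sum_(e in J) (c e)%:MP * 'X_e.

Lemma var_poly_free b (B : {set 'I_m}) : b \notin B ->
  var_poly b (\sum_(e in B) (c e)%:MP * 'X_e) = (\sum_(e in B) (c e)%:MP * 'X_e)%:P.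
Proof.
move=> bB; rewrite !rmorph_sum; apply: eq_bigr => e eB.
by rewrite !rmorphM /= var_polyC var_polyXn //; apply: contraNneq bB => <-.
Qed.

Lemma pivot_form_free a b : b \notin J -> a != b ->
  var_poly b (pivot_form a) = (pivot_form a)%:P.
Proof.
by move=> bJ ne_ab; rewrite rmorphB rmorphM /= var_polyC var_polyXn // var_poly_free //
  polyCB polyCM.
Qed.

Lemma pivot_form_lead a : a \notin J -> delta != 0 ->
  lead_coef (var_poly a (pivot_form a)) = delta%:MP.
Proof.
move=> aJ d0; have d1 : delta%:MP_[m] != 0 by rewrite mpolyC_eq0.
rewrite rmorphB rmorphM /= var_polyC var_polyX var_poly_free //.
exact: lead_coef_linear.
Qed.

End LinearForm.

(** For a basis I of variables modulo Q, each X_i outside I satisfies a relation in Q involving only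
    I and X_i. Its leading coefficient in X_i is a nonzero polynomial in the variables I, hence
    outside Q, and the other relations do not involve X_i. *)
Lemma prime_triangular_sequence (k : fieldType) d (Q : {mpoly k[d]} -> Prop) :
  prime_ideal Q -> exists f : nat -> {mpoly k[d]},
    triangular (fun u => ~ Q u) f (d - dim_mod Q) /\
    forall i, (i < d - dim_mod Q)%N -> Q (f i) /\ f i != 0.
Proof.
move=> Qprime; have [I QI cardI] := dim_mod_basis Qprime.
have [fx fxP] : exists fx : 'I_d -> {mpoly k[d]}, forall i, i \notin I ->
    [/\ in_vars (i |: I) (fx i), Q (fx i) & fx i != 0].
  suff /boolp.choice[fx fxP] : forall i, exists f, i \notin I ->
      [/\ in_vars (i |: I) f, Q f & f != 0] by exists fx.
  move=> i; have [Ii|Ii] := boolP (i \in I); first by exists 0.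
  by have [f fP] := dim_mod_dependent cardI Ii; exists f.
pose s := enum (~: I).
have szs : size s = (d - dim_mod Q)%N by rewrite -cardE cardsCs setCK card_ord -cardI.
have fs i : (i < d - dim_mod Q)%N -> exists i0 : 'I_d,
    [/\ i0 \notin I, [seq fx i | i <- s]`_i = fx i0 & index i0 s = i].
  rewrite -szs => lt_i; have x0 : 'I_d by case: (s) lt_i.
  exists (nth x0 s i); split.
  - by have := mem_nth x0 lt_i; rewrite mem_enum inE.
  - by rewrite (nth_map x0).
  - by rewrite index_uniq // enum_uniq.
exists (nth 0 [seq fx i | i <- s]); split; last first.
  by move=> i /fs[i0 [I0 -> _]]; have [_ Qf0 f0] := fxP i0 I0.
move=> i lt_i; have [i0 [I0 -> idx0]] := fs i lt_i; have [If0 Qf0 f0] := fxP i0 I0.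
exists (var_poly i0), 'X_i0; split; first exact: separates_var_poly.
  move=> j lt_j; have [j0 [Ij0 -> idxj]] := fs j (ltn_trans lt_j lt_i).
  have [Ifj _ _] := fxP j0 Ij0; apply: Ifj; rewrite !inE negb_or I0 andbT.
  by apply/eqP => e0; rewrite e0 idxj in idx0; rewrite idx0 ltnn in lt_j.
move=> Qlead; have Ilead : in_vars I (lead_coef (var_poly i0 (fx i0))).
  by rewrite lead_coefE; apply: in_vars_coef.
have /eqP := QI _ Ilead Qlead; rewrite lead_coef_eq0 => /eqP v0.
have [ev _ _] := separates_var_poly k i0.
by rewrite -(ev (fx i0)) /= v0 horner0 eqxx in f0.
Qed.

Section Append.
Variables (R : idomainType) (m : nat).
Notation S := {mpoly R[m]}.

(** Elements of R are constant in the T_a, and the form with pivot T_a otherwise involves only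
    variables indexed by J; so each pivot is absent from all the other terms. The elements of R come
    first, which places a term from R at index 0 whenever n1 > 0. *)
Lemma triangular_append (Q : R -> Prop) (f : nat -> R) n1 (J : {set 'I_m})
    (delta : 'I_m -> R) (c : 'I_m -> 'I_m -> R) : ~ ~ Q 0 ->
  triangular (fun u => ~ Q u) f n1 -> (forall a, a \notin J -> ~ Q (delta a)) ->
  exists g : nat -> S,
  [/\ triangular (off_prime (@mpolyC m R) Q) g (n1 + (m - #|J|)),
    forall i, (i < n1)%N -> g i = (f i)%:MP
  & forall i, (n1 <= i < n1 + (m - #|J|))%N ->
      exists2 a, a \notin J & g i = pivot_form J (delta a) (c a) a].
Proof.
move=> Q0 f_tri ndelta; pose h a := pivot_form J (delta a) (c a) a.
have h_free a b : b \notin J -> a != b -> var_poly b (h a) = (h a)%:P.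
  exact: pivot_form_free.
have h_lead a : a \notin J -> lead_coef (var_poly a (h a)) = (delta a)%:MP.
  move=> Ja; apply: pivot_form_lead => //; apply/eqP => d0; apply: Q0.
  by rewrite -d0; exact: ndelta.
have hE a : h a = pivot_form J (delta a) (c a) a by [].
clearbody h.
pose s := enum (~: J).
have szs : size s = (m - #|J|)%N by rewrite -cardE cardsCs setCK card_ord.
pose g i : S := if (i < n1)%N then (f i)%:MP else nth 0 (map h s) (i - n1).
have g1 i : (i < n1)%N -> g i = (f i)%:MP by rewrite /g => ->.
have g2 i : (n1 <= i < n1 + (m - #|J|))%N -> exists a : 'I_m,
    [/\ a \notin J, g i = h a & (n1 + index a s)%N = i].
  rewrite -szs => /andP[le_i lt_i]; have lt_i' : (i - n1 < size s)%N by lia.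
  have x0 : 'I_m by case: (s) lt_i'.
  exists (nth x0 s (i - n1)); split.
  - by have := mem_nth x0 lt_i'; rewrite mem_enum inE.
  - by rewrite /g ltnNge le_i (nth_map x0).
  - by rewrite index_uniq ?enum_uniq // subnKC.
clearbody g.
exists g; split=> //; last first.
  by move=> i /g2[a [Ja -> _]]; exists a.
move=> i lt_i; have [lt_i1|le_i1] := ltnP i n1.
  have [theta [y [sep fj Ulead]]] := f_tri i lt_i1.
  exists (lift_separation theta), y%:MP; split; first exact: separates_lift.
    move=> j lt_j; rewrite g1 ?(ltn_trans lt_j) // /= lift_separationC fj //.
    by rewrite map_polyC.
  rewrite g1 // /= lift_separationC lead_coef_map_inj //; last exact: can_inj (@mpolyCK m R).
  by exists (lead_coef (theta (f i))).
have [|a0 [J0 -> idx0]] := g2 i; first by rewrite le_i1.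
exists (var_poly a0), 'X_a0; split.
- exact: separates_var_poly.
- move=> j lt_j; have [lt_j1|le_j1] := ltnP j n1.
    by rewrite g1 // /= var_polyC.
  have [|a1 [J1 -> idx1]] := g2 j; first by rewrite le_j1 (ltn_trans lt_j).
  apply: h_free => //; apply/eqP => e0; rewrite e0 idx0 in idx1.
  by rewrite idx1 ltnn in lt_j.
- by exists (delta a0); [exact: ndelta|exact: h_lead].
Qed.

End Append.

(** * Gradings *)

Lemma prime_ideal_kernel (A B : idomainType) (f : A -> B) : {morph f : x y / x + y} ->
  {morph f : x y / x * y} -> f 1 = 1 -> prime_ideal (fun x => f x = 0).
Proof.
move=> fD fM f1; have f0 : f 0 = 0 by apply: (addrI (f 0)); rewrite -fD !addr0.
split; [split=> [//|x y|x y]| |move=> x y].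
- by rewrite fD => -> ->; rewrite addr0.
- by rewrite fM => ->; rewrite mulr0.
- by rewrite f1; apply/eqP; exact: oner_neq0.
- by rewrite fM => /eqP; rewrite mulf_eq0 => /orP[/eqP|/eqP]; [left|right].
Qed.

Section CoefGraded.
Variables (S : comNzRingType) (tau : {rmorphism S -> {poly S}}).

Definition coef_graded s := forall e, tau (tau s)`_e = ((tau s)`_e)%:P * 'X^e.

Lemma coef_gradedD s t : coef_graded s -> coef_graded t -> coef_graded (s + t).
Proof. by move=> Gs Gt e; rewrite rmorphD coefD rmorphD /= Gs Gt polyCD mulrDl. Qed.

Lemma coef_gradedM s t : coef_graded s -> coef_graded t -> coef_graded (s * t).
Proof.
move=> Gs Gt e; rewrite rmorphM coefM rmorph_sum rmorph_sum mulr_suml /=.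
apply: eq_bigr => j _; rewrite rmorphM /= Gs Gt polyCM mulrACA -exprD subnKC //.
by rewrite -ltnS.
Qed.

Lemma coef_graded_const s : tau s = s%:P -> coef_graded s.
Proof.
move=> sE e; rewrite sE coefC; case: eqP => [->|_]; first by rewrite sE expr0 mulr1.
by rewrite rmorph0 mul0r.
Qed.

Lemma coef_graded_lin s : tau s = s%:P * 'X -> coef_graded s.
Proof.
move=> sE e; rewrite sE coefCM coefX; have [->|_] := eqVneq e 1%N.
  by rewrite mulr1 sE expr1.
by rewrite mulr0 rmorph0 mul0r.
Qed.

Variable J : S -> Prop.
Hypothesis J_ideal : is_ideal J.

Lemma constant_part_congrD s t : J (s - (tau s)`_0) -> J (t - (tau t)`_0) ->
  J (s + t - (tau (s + t))`_0).
Proof.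
have [_ JD _] := J_ideal.
by rewrite rmorphD coefD opprD addrACA; apply: JD.
Qed.

Lemma constant_part_congrM s t : J (s - (tau s)`_0) -> J (t - (tau t)`_0) ->
  J (s * t - (tau (s * t))`_0).
Proof.
have [_ JD JM] := J_ideal; rewrite rmorphM coef0M => Js Jt.
have -> : s * t - (tau s)`_0 * (tau t)`_0 =
    t * (s - (tau s)`_0) + (tau s)`_0 * (t - (tau t)`_0) by ring.
by apply: JD; apply: JM.
Qed.

End CoefGraded.

Section LiftGrading.
Variables (A : idomainType) (m : nat) (theta : {rmorphism A -> {poly A}}).

Lemma is_grading_lift : is_grading theta -> is_grading (lift_separation (m := m) theta).
Proof.
move=> [ev grad]; split=> [s|].
  rewrite -[RHS]/(idfun s) -[LHS]/((horner_eval 1 \o lift_separation theta) s).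
  apply: mpoly_rmorph_eq => [c|j] /=; rewrite /horner_eval.
    rewrite lift_separationC -(rmorph1 (@mpolyC m A)) horner_map /=.
    by rewrite ev.
  by rewrite lift_separationX hornerC.
suff H : forall s : {mpoly A[m]}, coef_graded (lift_separation theta) s.
  by move=> s; exact: H.
elim/mpoly_gen_ind => [c|j|p q Gp Gq|p q Gp Gq].
- move=> e; rewrite /= !lift_separationC coef_map /= lift_separationC grad.
  by rewrite rmorphM /= map_polyC map_polyXn.
- by apply: coef_graded_const; rewrite /= lift_separationX.
- exact: coef_gradedD.
- exact: coef_gradedM.
Qed.

End LiftGrading.

Section StandardGrading.
Variables (k : fieldType) (d : nat).
Notation R := {mpoly k[d]}.

Definition degree_map : R -> {poly R} :=
  mmap (polyC \o @mpolyC d k) (fun i => ('X_i)%:P * 'X).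

HB.instance Definition _ := GRing.RMorphism.on degree_map.

Lemma degree_mapC c : degree_map c%:MP = (c%:MP)%:P.
Proof. by rewrite /degree_map mmapC. Qed.

Lemma degree_mapX i : degree_map 'X_i = ('X_i)%:P * 'X.
Proof. by rewrite /degree_map mmapX mmap1U. Qed.

Lemma is_grading_degree : is_grading degree_map.
Proof.
split=> [s|].
  rewrite -[RHS]/(idfun s) -[LHS]/((horner_eval 1 \o degree_map) s).
  apply: mpoly_rmorph_eq => [c|j] /=; rewrite /horner_eval.
    by rewrite degree_mapC hornerC.
  by rewrite degree_mapX hornerM hornerC hornerX mulr1.
suff H : forall s : R, coef_graded degree_map s by move=> s; exact: H.
elim/mpoly_gen_ind => [c|j|p q Gp Gq|p q Gp Gq].
- by apply: coef_graded_const; rewrite /= degree_mapC.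
- by apply: coef_graded_lin; rewrite /= degree_mapX.
- exact: coef_gradedD.
- exact: coef_gradedM.
Qed.

Lemma degree_map_homog e p : p \is e.-homog -> degree_map p = p%:P * 'X^e.
Proof.
move=> /dhomogP homp.
have mon nu : degree_map 'X_[nu] = ('X_[nu])%:P * 'X^(mdeg nu).
  rewrite mpolyXE_id !rmorph_prod mdegE -prodrXr -big_split /=.
  by apply: eq_bigr => j _; rewrite !rmorphXn /= degree_mapX exprMn.
rewrite [p]mpolyE big_seq.
apply: (big_ind (fun q => degree_map q = q%:P * 'X^e)) => [|q r qE rE|nu nup].
- by rewrite rmorph0 polyC0 mul0r.
- by rewrite rmorphD /= qE rE polyCD mulrDl.
- by rewrite -mul_mpolyC rmorphM /= degree_mapC mon polyCM -mulrA -(homp nu nup).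
Qed.

Lemma degree_map0 p : exists a : k, (degree_map p)`_0 = a%:MP.
Proof.
elim/mpoly_gen_ind: p => [c|i|p q [a pE] [b qE]|p q [a pE] [b qE]].
- by exists c; rewrite degree_mapC coefC.
- by exists 0; rewrite degree_mapX coefMX mpolyC0.
- by exists (a + b); rewrite mpolyCD -pE -qE -coefD -rmorphD.
- by exists (a * b); rewrite mpolyCM -pE -qE -coef0M -rmorphM.
Qed.

(** The ideal generated by the variables, described by a vanishing constant term: as the kernel of a
    ring map it is prime at once. *)
Definition irrelevant (p : R) : Prop := (degree_map p)`_0 = 0.

Lemma irrelevant_prime : prime_ideal irrelevant.
Proof.
apply: (@prime_ideal_kernel R R (fun p => (degree_map p)`_0)) => [p q|p q|].
- by rewrite rmorphD coefD.
- by rewrite rmorphM; exact: coef0M.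
- by rewrite rmorph1 coef1.
Qed.

End StandardGrading.

(** * The main theorem *)

(* Used instead of [{mpoly k[d]}] in [{mpoly R[m]}], where comparing the commutative ring
   structure with the one inherited from the integral domain is prohibitively slow. *)
Definition poly_ring (k : fieldType) (d : nat) : idomainType := {mpoly k[d]}.

(** Otherwise every chain ending in Q could be exchanged for a longer one, against the bound d on
    their lengths. *)
Lemma exists_height (k : fieldType) (d : nat) (Q : {mpoly k[d]} -> Prop) :
  prime_ideal Q -> exists h, height_eq Q h.
Proof.
move=> Qprime; apply: boolp.contrapT => nex.
have all_h h : height_ge Q h.
  elim: h => [|h IH]; first by exists (fun=> Q); split; [split|].
  by apply: boolp.contrapT => nh; apply: nex; exists h.
by have := height_ge_dim_mod (all_h d.+1); lia.
Qed.

Section Core.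
Variables (k : fieldType) (d r n : nat).
Notation R := (poly_ring k d).
Notation S := {mpoly R[r.+2]}.
Variables (alpha : 'rV[R]_r.+2) (phi : 'M[R]_(r.+2, r.+1)).
Hypothesis alpha_phi : alpha *m phi = 0.
Hypothesis alpha_ker : forall v : 'cV[R]_r.+2, alpha *m v = 0 -> exists w, v = phi *m w.
Hypothesis alpha_neq0 : exists a, alpha 0 a != 0.
Notation I := (ideal_of (fun x => exists i, x = alpha 0 i)).
Hypothesis alpha_G : G_cond I d.

Notation iota := (@mpolyC r.+2 R).
Notation l := (sym_eq (m := r.+2) phi).
Notation A := (rees_kernel (m := r.+2) alpha).

Let lin_spanE (F : S) : lin_span (S := S) l r.+1 F <-> sym_ideal (m := r.+2) phi F.
Proof. by split=> [FE|FE]; [apply/sym_idealP|apply/sym_idealP]. Qed.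

(** Positive dimension is what brings Q within reach of G_d: the height is at most d - dim Q, hence
    less than d. *)
Lemma pivots_in_prime (Q : R -> Prop) : prime_ideal Q -> (0 < dim_mod Q)%N -> subI I Q ->
  exists J : {set 'I_r.+2}, (#|J| <= d - dim_mod Q)%N /\
    forall a, exists delta (c : 'I_r.+2 -> R),
    ~ Q delta /\ delta * alpha 0 a = \sum_(e in J) c e * alpha 0 e.
Proof.
move=> Qprime dimQ IQ; have [h Qh] := exists_height Qprime.
have le_h := height_ge_dim_mod Qh.1.
have [|J [le_J JP]] := local_generating_subset Qprime (alpha_G Qprime IQ Qh _).
  by lia.
by exists J; split=> //; lia.
Qed.

(** If Q contains I, then |J| <= n1 gives at least r + 2 terms, one more than the r + 1 equations.
    If some alpha_i lies outside Q, then J = {i} yields r + 1 pivot forms, and in degree 0 a power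
    of alpha_i, a unit at Q, carries A into the ideal of the equations. *)
Lemma local_sequence (Q : R -> Prop) : prime_ideal Q -> (0 < dim_mod Q)%N -> exists f c,
  [/\ triangular (S := S) (off_prime iota Q) f c,
    forall i, (i < c)%N -> (exists2 x, f i = iota x & Q x) \/ lin_span (S := S) l r.+1 (f i),
    (r.+1 <= c)%N &
    (forall F, A F -> exists2 u, ~ Q u & lin_span (S := S) l r.+1 (iota u * F)) \/
    ((r.+1 < c)%N /\ exists2 x, f 0%N = iota x & x != 0)].
Proof.
move=> Qprime dimQ.
have [fx [fx_tri fxQ]] := prime_triangular_sequence Qprime.
have nnQ0 : ~ ~ Q 0 by move=> nQ0; apply: nQ0; exact: prime0.
set n1 := (d - dim_mod Q)%N in fx_tri fxQ.
have main (J : {set 'I_r.+2}) (delta : 'I_r.+2 -> R) (c : 'I_r.+2 -> 'I_r.+2 -> R) :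
    (forall a, ~ Q (delta a) /\ delta a * alpha 0 a = \sum_(e in J) c a e * alpha 0 e) ->
    exists f, [/\ triangular (S := S) (off_prime iota Q) f (n1 + (r.+2 - #|J|)),
    forall i, (i < n1 + (r.+2 - #|J|))%N ->
      (exists2 x, f i = iota x & Q x) \/ lin_span (S := S) l r.+1 (f i)
    & forall i, (i < n1)%N -> f i = iota (fx i)].
  move=> JP.
  have [g [g_tri g1 g2]] :=
    triangular_append c nnQ0 fx_tri (fun a (_ : a \notin J) => (JP a).1).
  exists g; split=> // i lt_i; have [lt_i1|le_i1] := ltnP i n1.
    by left; exists (fx i); [exact: g1|case: (fxQ i lt_i1)].
  right; apply/lin_spanE; have [|a Ja ->] := g2 i; first by rewrite le_i1.
  exact: (sym_ideal_relation alpha_ker Ja (JP a).2).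
have [IQ|nIQ] := boolp.pselect (subI I Q).
  have [J [le_J /boolp.choice[delta /boolp.choice[c cP]]]] := pivots_in_prime Qprime dimQ IQ.
  have [f [f_tri f_kind f1]] := main J delta c cP.
  (* Q contains a nonzero alpha_a, so it is strictly larger than the zero prime and its dimension is
     less than d. Hence the sequence does begin with an element of R. *)
  have n1_gt0 : (0 < n1)%N.
    have [a alpha_a] := alpha_neq0.
    have zero_prime : prime_ideal (fun x : R => x = 0).
      by apply: (@prime_ideal_kernel R R id).
    have : (dim_mod Q < dim_mod (fun x : R => x = 0%R))%N.
      apply: (dim_mod_lt (x := alpha 0 a) zero_prime Qprime) => [x ->||/eqP].
      - exact: prime0.
      - by apply: IQ; apply: ideal_of_gen; exists a.
      - by rewrite (negbTE alpha_a).
    by have := dim_mod_le (fun x : R => x = 0); rewrite /n1; lia.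
  have card_J : (#|J| <= r.+2)%N by rewrite (leq_trans (max_card _)) // card_ord.
  exists f, (n1 + (r.+2 - #|J|))%N; split=> //; first by rewrite /n1 in n1_gt0 *; lia.
  right; split; first by rewrite /n1 in n1_gt0 *; lia.
  by exists (fx 0%N); [exact: f1|case: (fxQ 0%N n1_gt0)].
have [i nQi] : exists i, ~ Q (alpha 0 i).
  apply: boolp.contrapT => nex; apply: nIQ => x /ideal_of_family[c ->].
  apply: prime_sum => // i _; apply: primeMr => //.
  by apply: boolp.contrapT => nQ; apply: nex; exists i.
have [|f [f_tri f_kind _]] := main [set i] (fun=> alpha 0 i) (fun a _ => alpha 0 a).
  by move=> a; split=> //; rewrite big_set1 mulrC.
exists f, (n1 + (r.+2 - #|[set i]|))%N; rewrite cards1 in f_tri f_kind *; split=> //.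
  by rewrite subn1 leq_addl.
left=> F AF; have [D LD] := rees_kernel_power (m := r.+2) alpha_ker i AF.
exists (alpha 0 i ^+ D); first by move/(primeX Qprime).
by apply/lin_spanE; rewrite rmorphXn.
Qed.

Hypothesis d_gt0 : (0 < d)%N.
Hypothesis n_gt0 : (0 < n)%N.
Hypothesis phi_linear : forall (i : 'I_r.+2) (j : 'I_r.+1), (j < r)%N ->
  (phi i j : {mpoly k[d]}) \is 1.-homog.
Hypothesis phi_last : forall (i : 'I_r.+2) (j : 'I_r.+1), j = r :> nat ->
  (phi i j : {mpoly k[d]}) \is n.-homog.

Definition x_degree : {rmorphism S -> {poly S}} :=
  lift_separation (A := R) (@degree_map k d).

Lemma x_degreeC c : x_degree c%:MP = map_poly iota (degree_map c).
Proof. exact: lift_separationC. Qed.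

Lemma x_degreeX j : x_degree 'X_j = ('X_j)%:P.
Proof. exact: lift_separationX. Qed.

Lemma is_grading_x_degree : is_grading x_degree.
Proof. exact: (is_grading_lift (A := R) r.+2 (@is_grading_degree k d)). Qed.

Definition x_var i : R := if insub i is Some i' then 'X_(i' : 'I_d) else 0.

Lemma x_var_ord (i : 'I_d) : x_var i = 'X_i.
Proof. by rewrite /x_var valK. Qed.

Lemma x_degree_var i : (i < d)%N -> x_degree (iota (x_var i)) = (iota (x_var i))%:P * 'X.
Proof.
move=> lt_i; rewrite -[i]/(val (Ordinal lt_i)) x_var_ord x_degreeC degree_mapX.
by rewrite rmorphM /= map_polyC map_polyX.
Qed.

Lemma x_degree_sym_eq j : (j < r.+1)%N ->
  x_degree (l j) = (l j)%:P * 'X^(if (j < r)%N then 1 else n).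
Proof.
move=> lt_j; pose j' := Ordinal lt_j; rewrite -[j]/(val j') sym_eq_ord.
rewrite !rmorph_sum mulr_suml; apply: eq_bigr => i _.
rewrite !rmorphM /= x_degreeX x_degreeC.
have -> : degree_map (phi i j') = (phi i j')%:P * 'X^(if (j < r)%N then 1 else n).
  apply: degree_map_homog; case: ifP => lt_jr; first exact: phi_linear.
  by apply: phi_last => /=; lia.
by rewrite rmorphM /= map_polyC map_polyXn mulrA.
Qed.

Lemma x_degree_positive s : (x_degree s)`_0 = 0 ->
  exists c : nat -> S, s = \sum_(i < d) c i * iota (x_var i).
Proof.
suff near_const : forall t : S,
    lin_span (S := S) (fun i => iota (x_var i)) d (t - (x_degree t)`_0).
  by move=> s0; have := near_const s; rewrite s0 subr0.
have idJ := @lin_span_ideal S (fun i => iota (x_var i)) d.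
have [J0 _ _] := idJ.
elim/mpoly_gen_ind => [c|j|p q Ip Iq|p q Ip Iq].
- elim/mpoly_gen_ind: c => [a|i|p q Ip Iq|p q Ip Iq].
  + by rewrite x_degreeC coef_map degree_mapC coefC subrr.
  + rewrite x_degreeC coef_map degree_mapX coefMX /= mpolyC0 subr0 -x_var_ord.
    exact: (@lin_span_gen S (fun i => iota (x_var i)) d i (ltn_ord i)).
  + by rewrite mpolyCD; exact: (constant_part_congrD idJ Ip Iq).
  + by rewrite mpolyCM; exact: (constant_part_congrM idJ Ip Iq).
- by rewrite x_degreeX coefC subrr.
- exact: (constant_part_congrD idJ Ip Iq).
- exact: (constant_part_congrM idJ Ip Iq).
Qed.

Lemma x_degree_unit u : ~ irrelevant u ->
  exists2 v : S, x_degree v = v%:P & v * (x_degree (iota u))`_0 = 1.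
Proof.
move=> nu; have [a aE] := degree_map0 u.
have a0 : a != 0 by apply: contra_notN nu => /eqP a0; rewrite /irrelevant aE a0 mpolyC0.
exists (iota (a^-1)%:MP).
  by rewrite x_degreeC degree_mapC map_polyC.
by rewrite x_degreeC coef_map aE -mpolyCM -mpolyCM mulVf // !mpolyC1.
Qed.

Lemma x_var_triangular : triangular (S := S) (fun s => s = 1) (fun i => iota (x_var i)) d.
Proof.
move=> i lt_i; pose i' := Ordinal lt_i.
exists (lift_separation (A := R) (@var_poly k d i')), (iota 'X_i'); split.
- exact: (separates_lift (A := R) r.+2 (separates_var_poly k i')).
- move=> j lt_j; have lt_jd := ltn_trans lt_j lt_i.
  rewrite -[j]/(val (Ordinal lt_jd)) x_var_ord /= lift_separationC /=.
  rewrite var_polyXn ?map_polyC // -val_eqE /=; by rewrite ltn_eqF.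
- rewrite -[i]/(val i') x_var_ord /= lift_separationC /= var_polyX map_polyX.
  exact: lead_coefX.
Qed.

Theorem rees_kernel_mul_sym_ideal F y : A F -> (forall e, (e < n)%N -> (x_degree y)`_e = 0) ->
  sym_ideal (m := r.+2) phi (F * y).
Proof.
move=> AF y0; apply/lin_spanE.
have A_cancel x (s : S) : x != 0 -> A (iota x * s) -> A s.
  exact: rees_cancel.
have span_A (s : S) : lin_span (S := S) l r.+1 s -> A s.
  by move=> /lin_spanE; apply: (sym_ideal_sub_rees (m := r.+2) alpha_phi).
pose dg j := if (j < r)%N then 1%N else n.
have A_prime : prime_ideal (R := S : idomainType) A.
  apply: (@prime_ideal_kernel S {poly R} (rees_map (m := r.+2) alpha)) => [p q|p q|].
  - exact: rmorphD.
  - exact: rmorphM.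
  - exact: rmorph1.
have A_torsion (G : S) : A G -> exists2 u : R, u != 0 & lin_span (S := S) l r.+1 (iota u * G).
  move=> AG; have [a alpha_a] := alpha_neq0.
  have [D LD] := rees_kernel_power (m := r.+2) alpha_ker a AG.
  exists (alpha 0 a ^+ D); first by rewrite expf_neq0.
  by apply/lin_spanE; rewrite rmorphXn.
(* A prime strictly below the irrelevant ideal has larger dimension, hence positive dimension, so
   exactness there is available. *)
have exact_below (z : R) Q : irrelevant z -> prime_ideal Q -> subI Q (@irrelevant k d) ->
    ~ Q z -> exact_at (S := S) iota l r.+1 A Q.
  move=> Pz Qprime QP nQz.
  have lt_dim := dim_mod_lt Qprime (@irrelevant_prime k d) QP Pz nQz.
  apply: (@exact_at_prime R S iota l r.+1 A (can_inj (@mpolyCK r.+2 R)) span_A A_cancel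
    (@dim_mod k d) (@dim_mod_lt k d) d (@dim_mod_le k d) local_sequence Q Qprime).
  exact: leq_ltn_trans lt_dim.
have P_x i : (i < d)%N -> irrelevant (x_var i).
  move=> lt_i; rewrite -[i]/(val (Ordinal lt_i)) x_var_ord /irrelevant degree_mapX.
  by rewrite coefMX.
have x0 : x_var 0 != 0.
  rewrite -[0%N]/(val (Ordinal d_gt0)) x_var_ord.
  apply/eqP => /(congr1 (mcoeff U_(Ordinal d_gt0))).
  by rewrite mcoeffX eqxx mcoeff0 => /eqP; rewrite oner_eq0.
have dg1 j : (j < r)%N -> dg j = 1%N by rewrite /dg => ->.
have dgn : dg r = n by rewrite /dg ltnn.
exact: (@rees_mul_lin_span R S iota l r A (@irrelevant k d) x_degree d n x_var dg
  span_A A_cancel A_prime A_torsion (@irrelevant_prime k d) exact_below is_grading_x_degree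
  d_gt0 n_gt0 P_x x0 x_degree_var x_degree_sym_eq dg1 dgn x_degree_positive x_degree_unit
  x_var_triangular F y AF y0).
Qed.

End Core.

Lemma ideal_pow_exp (S : comNzRingType) (X : S -> Prop) x n : X x -> ideal_pow X n (x ^+ n).
Proof.
move=> Xx; elim: n => //= n IH; apply: ideal_of_gen.
by exists (x ^+ n), x; rewrite exprSr.
Qed.

Lemma ideal_pow_order (S : comNzRingType) (tau : {rmorphism S -> {poly S}}) (X : S -> Prop) n y :
  (forall x, X x -> (tau x)`_0 = 0) -> ideal_pow X n y ->
  forall e, (e < n)%N -> (tau y)`_e = 0.
Proof.
move=> X0; elim: n y => // n IH _ /= [N [g [c [gX ->]]]] e lt_e.
rewrite rmorph_sum coef_sum big1 // => i _; have [a [b [Xa Xb ->]]] := gX i.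
rewrite !rmorphM /= coefM big1 // => j _.
suff -> : (tau a * tau b)`_(e - j) = 0 by rewrite mulr0.
rewrite coefM big1 // => u _.
have [lt_u|le_u] := ltnP u n; first by rewrite (IH a) ?mul0r.
have -> : (e - j - u)%N = 0%N by have := ltn_ord u; lia.
by rewrite X0 ?mulr0.
Qed.

Section Colon.
Variables (k : fieldType) (d r n : nat).
Notation R := (poly_ring k d).
Notation S := {mpoly R[r.+2]}.
Variables (alpha : 'rV[R]_r.+2) (phi : 'M[R]_(r.+2, r.+1)).
Hypothesis alpha_phi : alpha *m phi = 0.
Hypothesis alpha_ker : forall v : 'cV[R]_r.+2, alpha *m v = 0 -> exists w, v = phi *m w.
Hypothesis alpha_neq0 : exists a, alpha 0 a != 0.
Hypothesis alpha_G : G_cond (ideal_of (fun x => exists i, x = alpha 0 i)) d.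
Hypothesis d_gt0 : (0 < d)%N.
Hypothesis n_gt0 : (0 < n)%N.
Hypothesis phi_linear : forall (i : 'I_r.+2) (j : 'I_r.+1), (j < r)%N ->
  (phi i j : {mpoly k[d]}) \is 1.-homog.
Hypothesis phi_last : forall (i : 'I_r.+2) (j : 'I_r.+1), j = r :> nat ->
  (phi i j : {mpoly k[d]}) \is n.-homog.

Theorem rees_kernel_colon (F : S) : rees_kernel (m := r.+2) alpha F <->
  colon (sym_ideal (m := r.+2) phi)
    (ideal_pow (ideal_of (fun G : S => exists i : 'I_d, G = ('X_i : R)%:MP)) n) F.
Proof.
split=> [AF y Xy|colF].
  apply: (rees_kernel_mul_sym_ideal alpha_phi alpha_ker alpha_neq0 alpha_G d_gt0 n_gt0
    phi_linear phi_last AF).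
  apply: ideal_pow_order Xy => x /ideal_of_family[c ->].
  rewrite rmorph_sum coef_sum big1 // => i _; rewrite rmorphM coef0M x_degreeC coef_map.
  by rewrite degree_mapX coefMX /= mpolyC0 mulr0.
pose x0 : R := 'X_(Ordinal d_gt0).
have x0_neq0 : x0 ^+ n != 0.
  rewrite expf_neq0 //; apply/eqP => /(congr1 (mcoeff U_(Ordinal d_gt0))).
  by rewrite mcoeffX eqxx mcoeff0 => /eqP; rewrite oner_eq0.
apply: (rees_cancel (m := r.+2) x0_neq0); apply: (sym_ideal_sub_rees (m := r.+2) alpha_phi).
rewrite mulrC rmorphXn; apply: colF; apply: ideal_pow_exp.
by apply: ideal_of_gen; exists (Ordinal d_gt0).
Qed.

End Colon.

Lemma zero_height_lt (A : idomainType) : ~ height_ge (fun x : A => x = 0) 1.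
Proof.
move=> [c [[c_prime c_lt] c1]]; have [c01 [x [cx ncx]]] := c_lt 0%N isT.
by apply: ncx; have -> := (c1 x).1 cx; exact: prime0 (c_prime 0%N isT).
Qed.

(** The chain is shortened at its lower end, since its last member has to remain P. *)
Lemma height_ge_leq (A : comNzRingType) (P : A -> Prop) h h' :
  (h <= h')%N -> height_ge P h' -> height_ge P h.
Proof.
move=> le_h [c [[c_prime c_lt] cP]]; exists (fun i => c (i + (h' - h))%N); split.
  split=> i le_i; [apply: c_prime|apply: (c_lt (i + (h' - h))%N)]; lia.
by rewrite subnKC.
Qed.

Theorem theorem3p7 (k : fieldType) (d m n : nat)
  (alpha : 'rV[{mpoly k[d]}]_m) (phi : 'M[{mpoly k[d]}]_(m, m.-1)) :
  (d < m)%N ->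
  perfect (ideal_row alpha) ->
  ideal_height_eq (ideal_row alpha) 2 ->
  hilbert_burch alpha phi ->
  (forall (i : 'I_m) (j : 'I_(m.-1)), (j < m.-2)%N -> phi i j \is 1.-homog) ->
  (forall (i : 'I_m) (j : 'I_(m.-1)), nat_of_ord j = m.-2 -> phi i j \is n.-homog) ->
  (1 <= n)%N ->
  G_cond (ideal_row alpha) d ->
  forall F : {mpoly {mpoly k[d]}[m]},
    rees_ideal alpha F <-> colon (L_ideal phi) (ideal_pow (@xS k d m) n) F.
Proof.
move=> lt_dm _ [[P [Pprime _ [P_height _]]] height2] [alpha_phi alpha_ker _].
move=> phi_lin phi_last n_gt0 alpha_G F.
(* A prime with a chain of length 2 below it exists, so d >= 2; together with d < m this also gives
   m >= 2, used below to write m as r + 2. *)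
have d_gt0 : (0 < d)%N by have := height_ge_dim_mod P_height; lia.
(* Were all alpha_a zero, the zero prime would contain I and so have height at least 2, while no
   prime lies strictly below it. *)
have alpha_neq0 : exists a, alpha 0 a != 0.
  apply: boolp.contrapT => nex.
  have zero_prime : prime_ideal (fun x : {mpoly k[d]} => x = 0).
    by apply: (@prime_ideal_kernel (poly_ring k d) (poly_ring k d) id).
  apply: (@zero_height_lt (poly_ring k d)); apply: (@height_ge_leq _ _ 1 2) => //.
  apply: height2 zero_prime _ => x /ideal_of_family[c ->].
  rewrite big1 // => a _; suff -> : alpha 0 a = 0 by rewrite mulr0.
  by apply/eqP; apply: contra_notT nex => a0; exists a.
case: m lt_dm alpha phi alpha_phi alpha_ker phi_lin phi_last alpha_G alpha_neq0 F
    {height2} => [|[|r]] lt_dm alpha phi alpha_phi alpha_ker phi_lin phi_last alpha_G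
    alpha_neq0 F; try by lia.
exact: (@rees_kernel_colon k d r n alpha phi alpha_phi alpha_ker alpha_neq0 alpha_G
  d_gt0 n_gt0 phi_lin phi_last F).
Qed.
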